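(* Let $K$ be an algebraically closed field of characteristic $0$, $n\in\mathbb{N}$, let $\widetilde Z\subseteq\mathbb{P}^n_K$ be a projective (closed sub)scheme, assume $p=(1:0:\cdots:0)\in\mathbb{P}^n_K\setminus\widetilde Z$, and let $\pi:\widetilde Z\twoheadrightarrow Z\subseteq\mathbb{P}^{n-1}_K$ be the outer simple linear projection from $p$. Let $\lambda=(\lambda_1,\dots,\lambda_e)$ be a partition of $k\in\mathbb{N}$, let $G$ be a Gröbner basis of $I_{\widetilde Z}$ with respect to an elimination ordering on $R$, and let $F_1,\dots,F_s$ be generators of $I(X_\lambda)\subseteq K[z_0,\dots,z_k]$. Then, set-theoretically, $$I(Z_\lambda)=\Big\langle\{\mathrm{LC}_{x_0}(g)\mid g\in G_{x_0,k-1}\}\cup\{F_i(g)\mid i\in\{1,\dots,s\},\ g\in G^\circ_{x_0,k}\}\Big\rangle ,$$ that is, $Z_\lambda$ is set-theoretically defined by the ideal of $S$ on the right-hand side.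
   Context: Notation. $\mathbb{N}$ denotes the positive integers. $R=K[x_0,\dots,x_n]$ is the homogeneous coordinate ring of $\mathbb{P}^n_K$; the homogeneous ideal of $p=(1:0:\cdots:0)$ is $\mathfrak{p}=\langle x_1,\dots,x_n\rangle$, and $S:=K[x_1,\dots,x_n]\subset R$. The simple linear projection $\mathbb{P}^n_K\setminus\{p\}\to\mathbb{P}^{n-1}_K=\mathrm{Proj}(S)$ is given by the inclusion $S\hookrightarrow R$; $\pi$ is its restriction to $\widetilde Z$ and $Z$ is the image of $\widetilde Z$. $I_{\widetilde Z}\subseteq R$ is the saturated homogeneous ideal with $\widetilde Z=\mathrm{Proj}(R/I_{\widetilde Z})$. An elimination ordering is a monomial ordering on $R$ in which every monomial divisible by $x_0$ is greater than every monomial in $K[x_1,\dots,x_n]$. The Gröbner basis $G$ consists of homogeneous elements. A set $Y$ of closed points of $\mathbb{P}^{n-1}_K$ is set-theoretically defined by an ideal $J\subseteq S$ if, for every closed point $q\in\mathbb{P}^{n-1}_K$ with homogeneous ideal $\mathfrak{q}\subset S$, one has $q\in Y\iff J\subseteq\mathfrak{q}$. Fibers. For a closed point $q\in Z$ with homogeneous ideal $\mathfrak{q}\subset S$, the projective line $\langle q,p\rangle=\mathbb{P}^1_K$ spanned by $q$ and $p$ is $\mathrm{Proj}(R/\mathfrak{q}R)$. The fiber $\pi^{-1}(q)=\widetilde Z\cap\langle q,p\rangle$ is a closed subscheme of finite length of $\langle q,p\rangle$, hence an effective divisor on $\mathbb{P}^1_K$; its length is the degree of this divisor. For $k\in\mathbb{N}$,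 $Z_k$ is the set of closed points $q\in Z$ such that $\pi^{-1}(q)$ has length $\geq k$. Partitions. A partition of $k$ is a family $\lambda=(\lambda_1,\dots,\lambda_e)$ of positive integers with $\lambda_1+\dots+\lambda_e=k$. The $\lambda$-ramification locus of $\pi$ is $$Z_\lambda:=\Big\{q\in Z\text{ closed point}\ \Big|\ \exists\,\widetilde q_1,\dots,\widetilde q_e\in\langle q,p\rangle:\ \pi^{-1}(q)=\sum_{i=1}^e\lambda_i\widetilde q_i\Big\}\cup Z_{k+1},$$ where the closed points $\widetilde q_1,\dots,\widetilde q_e$ need not be distinct and the equality is one of divisors on $\langle q,p\rangle$. $I(Z_\lambda)\subseteq S$ denotes its homogeneous ideal. Polynomials in $x_0$. $R=S[x_0]$; for $g\in R$, $\deg_{x_0}(g)$ and $\mathrm{LC}_{x_0}(g)\in S$ are its degree and leading coefficient as a polynomial in $x_0$ over $S$. For $m\in\mathbb{N}_0$, $G_{x_0,m}:=\{g\in G\mid\deg_{x_0}(g)\leq m\}$, and $G^\circ_{x_0,k}:=\{g\in G\mid\deg_{x_0}(g)=k\}$. Coincident root loci. Let $K[x,y]$ be a polynomial ring in two variables. A point $(a_0:\dots:a_k)\in\mathbb{P}^k_K$ is identified with the binary form $\sum_{j=0}^ka_jx^{k-j}y^j$ up to a nonzero scalar. The $\lambda$-coincident root locus $X_\lambda\subseteq\mathbb{P}^k_K$ is the projective variety of binary forms of degree $k$ that can be written as $\prod_{i=1}^eL_i^{\lambda_i}$ with linear forms $L_1,\dots,L_e\in K[x,y]_1$ (not necessarily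 distinct). $K[z_0,\dots,z_k]$ is the homogeneous coordinate ring of $\mathbb{P}^k_K$ (with $z_j$ corresponding to $a_j$), and $I(X_\lambda)\subseteq K[z_0,\dots,z_k]$ is the homogeneous vanishing ideal of $X_\lambda$. Evaluation. For $g=\sum_{i=0}^kg_ix_0^{k-i}\in R$ with $g_0,\dots,g_k\in S$ and $F\in K[z_0,\dots,z_k]$, set $F(g):=F(g_0,\dots,g_k)\in S$. *)

(* Defs.v *)
From HB Require Import structures.
From mathcomp Require Import all_boot all_order all_algebra.
From mathcomp Require Import mpoly.

Set Implicit Arguments.
Unset Strict Implicit.
Unset Printing Implicit Defensive.

Import GRing.Theory.
Local Open Scope ring_scope.

(* Ideals are predicates in Prop, not necessarily proper: the unit ideal
   corresponds to the empty subscheme. *)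
Section Ideals.
Variable A : comNzRingType.
Implicit Types (I X : A -> Prop).

Definition is_ideal I :=
  [/\ I 0, forall f g, I f -> I g -> I (f + g) & forall r f, I f -> I (r * f)].

Definition ideal_gen X (f : A) :=
  exists s : seq (A * A),
    (forall u, u \in s -> X u.2) /\ f = \sum_(u <- s) u.1 * u.2.
End Ideals.

(* A closed point of P^m is represented by a nonzero row vector v : 'rV_m.+1;
   two nonzero vectors give the same point iff [(v == w)%MS] (equal spans). *)
Section Projective.
Variables (K : fieldType) (m : nat).
Implicit Types (v : 'rV[K]_m) (f : {mpoly K[m]}).

(* The homogeneous ideal of the point v: the polynomials all of whose
   homogeneous components vanish at v. *)
Definition pt_ideal v f :=
  forall d, (pihomog mdeg d f).@[fun i => v 0 i] = 0.

Definition vanishing_ideal (Y : 'rV[K]_m -> Prop) f :=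
  forall v, v != 0 -> Y v -> pt_ideal v f.

Definition set_defined_by (Y : 'rV[K]_m -> Prop) (J : {mpoly K[m]} -> Prop) :=
  forall v, v != 0 -> (Y v <-> (forall f, J f -> pt_ideal v f)).

(* Closed subschemes Proj(K[x]/I) of projective space correspond bijectively
   to the saturated homogeneous ideals I. *)
Definition saturated_homogeneous_ideal (I : {mpoly K[m]} -> Prop) :=
  [/\ is_ideal I,
      forall f d, I f -> I (pihomog mdeg d f)
    & forall f, (forall i, exists N, I ('X_i ^+ N * f)) -> I f].

Definition closed_point_of (I : {mpoly K[m]} -> Prop) v :=
  v != 0 /\ forall f, I f -> pt_ideal v f.
End Projective.

Section Groebner.
Variables (K : fieldType) (m : nat).
Implicit Types (le : rel 'X_{1..m}) (f : {mpoly K[m]}).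

Definition monomial_ordering le :=
  [/\ total le, antisymmetric le, transitive le,
      forall m1 m2 m3, le m1 m2 -> le (m1 + m3)%MM (m2 + m3)%MM
    & forall m1, le 0%MM m1].

Definition is_leading_term le f (t : {mpoly K[m]}) :=
  exists m0, [/\ m0 \in msupp f, forall m1, m1 \in msupp f -> le m1 m0
               & t = f@_m0 *: 'X_[m0]].

Definition leading_ideal le (X : {mpoly K[m]} -> Prop) :=
  ideal_gen (fun t => exists f, X f /\ is_leading_term le f t).

Definition groebner_basis le (I : {mpoly K[m]} -> Prop) (G : seq {mpoly K[m]}) :=
  (forall g, g \in G -> I g) /\
  (forall f, leading_ideal le I f <-> leading_ideal le (fun g => g \in G) f).
End Groebner.

Definition elimination_ordering n (le : rel 'X_{1..n.+1}) :=
  monomial_ordering le /\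
  forall m1 m2 : 'X_{1..n.+1},
    (0 < m1 ord0)%N -> m2 ord0 = 0%N -> le m2 m1 /\ ~~ le m1 m2.

(* R = K[x_0..x_n] is {mpoly K[n.+1]} and S = K[x_1..x_n] is {mpoly K[n]}, so
   the variable x_(j+1) of R is 'X_j in S. *)
Section Projection.
Variables (K : fieldType) (n : nat).
Implicit Types (I : {mpoly K[n.+1]} -> Prop) (q : 'rV[K]_n).
Implicit Types (g : {mpoly K[n.+1]}) (D : seq ('rV[K]_2 * nat)).

(* The identification R = S[x_0]. *)
Definition x0poly g : {poly {mpoly K[n]}} :=
  mmap (polyC \o @mpolyC n K)
       (fun i : 'I_n.+1 =>
          if unlift ord0 i is Some j then ('X_j : {mpoly K[n]})%:P else 'X) g.

Definition center : 'rV[K]_n.+1 := delta_mx 0 ord0.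

Definition proj_pt (z : 'rV[K]_n.+1) : 'rV[K]_n := \row_j z 0 (lift ord0 j).

(* Closed points of the image Z of the projection. *)
Definition image_pt I q :=
  q != 0 /\ exists z, closed_point_of I z /\ (proj_pt z == q)%MS.

(* The line <q,p> = Proj(R/qR), with R/qR identified with K[s,t] = {mpoly K[2]}
   by x_0 |-> s and x_j |-> q_j t; the point (a_0:a_1) is (a_0 : a_1 q). *)
Definition restrict_line q g : {mpoly K[2]} :=
  g \mPo [tuple if unlift ord0 i is Some j then q 0 j *: 'X_1 else 'X_0
         | i < n.+1].

(* The image in K[s,t] of the ideal of Z~: it defines the fiber on <q,p>. *)
Definition fiber_ideal I q (f : {mpoly K[2]}) :=
  exists2 g, I g & f = restrict_line q g.

(* The coefficient at the point a of the effective divisor on P^1 defined by J: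
   the least order of vanishing at a of the elements of J. *)
Definition mult_at (J : {mpoly K[2]} -> Prop) (a : 'rV[K]_2) (r : nat) :=
  let L : {mpoly K[2]} := a 0 1 *: 'X_0 - a 0 0 *: 'X_1 in
  (forall f, J f -> exists h : {mpoly K[2]}, f = h * L ^+ r) /\
  ~ (forall f, J f -> exists h : {mpoly K[2]}, f = h * L ^+ r.+1).

(* The list D of weighted points encodes the divisor \sum_(bm <- D) bm.2 [bm.1];
   the points need not be distinct. *)
Definition div_coef D (a : 'rV[K]_2) : nat :=
  (\sum_(bm <- D | (bm.1 == a)%MS) bm.2)%N.

Definition div_degree D : nat := (\sum_(bm <- D) bm.2)%N.

Definition fiber_divisor I q D :=
  (forall bm, bm \in D -> bm.1 != 0) /\
  (forall a, a != 0 -> mult_at (fiber_ideal I q) a (div_coef D a)).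

Definition Zlength_ge I (k : nat) q :=
  image_pt I q /\ exists D, fiber_divisor I q D /\ (k <= div_degree D)%N.

Definition ramification_locus I (k e : nat) (lambda : 'I_e -> nat) q :=
  (image_pt I q /\
   exists qt : 'I_e -> 'rV[K]_2,
     fiber_divisor I q [seq (qt i, lambda i) | i <- enum 'I_e]) \/
  Zlength_ge I k.+1 q.

(* F(g) for g = \sum_i g_i x_0^(k-i). *)
Definition eval_coefs (k : nat) (F : {mpoly K[k.+1]}) g : {mpoly K[n]} :=
  F \mPo [tuple (x0poly g)`_(k - i) | i < k.+1].

(* [size (x0poly g)] is 1 + deg_x0 g, and 0 for g = 0. *)
Definition ramification_ideal (k s : nat) (F : 'I_s -> {mpoly K[k.+1]})
    (G : seq {mpoly K[n.+1]}) :=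
  ideal_gen (fun h : {mpoly K[n]} =>
    (exists g, [/\ g \in G, (size (x0poly g) <= k)%N
                 & h = lead_coef (x0poly g)]) \/
    (exists i g, [/\ g \in G, size (x0poly g) = k.+1
                   & h = eval_coefs (F i) g])).
End Projection.

Definition is_partition e (lambda : 'I_e -> nat) (k : nat) :=
  (forall i, 0 < lambda i)%N /\ (\sum_(i < e) lambda i)%N = k.

Section Coincident.
Variable K : fieldType.

Definition binary_form k (a : 'rV[K]_k.+1) : {mpoly K[2]} :=
  \sum_(j < k.+1) a 0 j *: ('X_0 ^+ (k - j) * 'X_1 ^+ j).

Definition coincident_root_locus k e (lambda : 'I_e -> nat) (a : 'rV[K]_k.+1) :=
  a != 0 /\
  exists (c : K) (L : 'I_e -> {mpoly K[2]}),
    [/\ c != 0, forall i, L i \is 1.-homog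
      & c *: binary_form a = \prod_(i < e) L i ^+ lambda i].
End Coincident.

(* Main.v *)
From HB Require Import structures.
Require Import Defs.
From mathcomp Require Import all_boot all_order all_algebra.
From mathcomp Require Import fingroup perm.
From mathcomp Require Import mpoly.
From Stdlib Require Import Classical.

Set Implicit Arguments.
Unset Strict Implicit.
Unset Printing Implicit Defensive.

Import GRing.Theory.
Local Open Scope ring_scope.

(** Fix a nonzero vector v. Evaluating coefficients at v restricts R = S[x_0] to
    the line joining v to the centre p; this is the ring morphism [fiber_poly v]
    from R to K[x_0]. It maps I onto an ideal, which is nonzero because p lies
    off the subscheme: I contains a homogeneous element monic in x_0
    ([monic_mem]). Let u be the monic generator ([fiber_equation]). The fiber
    over v is the divisor of zeros of u on the line, with no mass at p
    ([fiber_mult]), so its length is the degree of u, and a list of weighted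
    points represents it exactly when u is the corresponding product of powers
    of linear factors ([fiber_divisor_factors], [fiber_divisor_equation]).

    The degree of u can be read off G. An element of I may drop in degree when
    it is restricted to the line, but R/I is a finite S-module, so a Nakayama
    argument gives an element of I whose x_0-degree is exactly deg u and whose
    leading coefficient does not vanish at v ([specialized_degree_lift]).
    An elimination ordering compares x_0-degrees first, so division by G turns
    this element into a member of G with the same property
    ([leading_coefs_vanish], [groebner_fiber_equation]). All members of G of
    smaller x_0-degree restrict to multiples of u of too small a degree, that
    is, to 0. Hence the leading coefficients of the members of x_0-degree below
    k all vanish at v if and only if deg u >= k. Assume this. If deg u > k, then
    v lies in the ramification locus and every member of x_0-degree k restricts
    to 0. If deg u = k, every member of x_0-degree k restricts to a multiple of
    u, a nonzero one at least once, so the conditions F_i(g)(v) = 0 say that the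
    coefficient vector of u is a zero of the ideal of the coincident root locus.

    It remains to see that such a zero is a point of the locus, i.e. that the
    locus is closed away from the forms divisible by y
    ([coincident_root_locus_closed]). Rather than by properness, this is shown
    by writing equations: a linear form in the roots that vanishes on the
    required pattern of coincidences is multiplied over all permutations of the
    roots, and the symmetric product is a polynomial in the coefficients
    ([resolvent_exists]).

    The generators F_i need not be homogeneous, so neither need F_i(g) be, and
    lying in the homogeneous ideal of v is tested on all the multiples c v with
    c nonzero ([pt_idealP]). *)

(** * Vanishing at a projective point *)

Section Evaluation.
Variables (K : fieldType) (m : nat).
Implicit Types (v : 'rV[K]_m) (f g : {mpoly K[m]}).

Lemma dhomog_scale d f (c : K) (w : 'I_m -> K) :
  f \is d.-homog -> f.@[fun i => c * w i] = c ^+ d * f.@[w].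
Proof.
move=> /dhomogP hf; rewrite !mevalE big_distrr /=; apply: eq_big_seq => mm hm.
rewrite mulrCA; congr (_ * _); rewrite -(hf _ hm) /= mdegE -prodrXr -big_split /=.
by apply: eq_bigr => i _; rewrite exprMn.
Qed.

Lemma meval_pihomog f (c : K) v :
  f.@[fun i => c * v 0 i] =
  (\poly_(d < msize f) (pihomog mdeg d f).@[fun i => v 0 i]).[c].
Proof.
rewrite {1}(pihomog_partitionE (leqnn (msize f))) rmorph_sum /= horner_poly.
apply: eq_bigr => d _; rewrite (dhomog_scale _ _ (pihomogP _ _ _)).
by rewrite mulrC.
Qed.

Lemma pt_ideal_scale v f c : pt_ideal v f -> f.@[fun i => c * v 0 i] = 0.
Proof.
by move=> h; rewrite meval_pihomog horner_poly big1 // => d _; rewrite h mul0r.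
Qed.

Lemma pt_ideal_meval v f : pt_ideal v f -> f.@[fun i => v 0 i] = 0.
Proof.
by move=> /(pt_ideal_scale 1) <-; apply: meval_eq => i; rewrite mul1r.
Qed.

Lemma ideal_gen_id (X : {mpoly K[m]} -> Prop) f : X f -> ideal_gen X f.
Proof.
move=> h; exists [:: (1, f)]; split=> [u|]; last by rewrite big_seq1 mul1r.
by rewrite inE => /eqP->.
Qed.
End Evaluation.

Section Points.
Variables (K : closedFieldType) (m : nat).
Implicit Types (v : 'rV[K]_m) (f : {mpoly K[m]}).

(** The value at c v is a polynomial in c whose coefficients are the values at v
    of the homogeneous components, and K is infinite. Testing on the multiples of
    v makes it evident that [pt_ideal v] is an ideal. *)
Lemma pt_idealP v f :
  pt_ideal v f <-> forall c, c != 0 -> f.@[fun i => c * v 0 i] = 0.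
Proof.
split=> [h c _ | h].
  rewrite meval_pihomog horner_poly big1 // => d _.
  by rewrite h mul0r.
pose P := \poly_(d < msize f) (pihomog mdeg d f).@[fun i => v 0 i].
have P0 : P = 0.
  apply/eqP; apply: contraTT isT => Pn0.
  have : P * 'X != 0 by rewrite mulf_neq0 ?polyX_eq0.
  case/closed_nonrootP=> c; rewrite /root hornerM hornerX.
  have [->|c0] := eqVneq c 0; first by rewrite mulr0 eqxx.
  by rewrite -meval_pihomog h // mul0r eqxx.
move=> d; have := congr1 (fun p : {poly K} => p`_d) P0.
rewrite coef0 coef_poly; case: ltnP => // hd _.
rewrite pihomogE big_seq_cond big_pred0 ?meval0 // => mm.
apply/negP=> /andP[hm /eqP e]; move: (msize_mdeg_lt hm).
by rewrite e ltnNge hd.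
Qed.

(** Generators need not be homogeneous here. *)
Lemma pt_ideal_gen v (X : {mpoly K[m]} -> Prop) :
  (forall f, X f -> pt_ideal v f) -> forall f, ideal_gen X f -> pt_ideal v f.
Proof.
move=> hX f [s [hs ->]]; apply/pt_idealP => c c0.
rewrite rmorph_sum big1_seq //= => u /hs /hX /pt_idealP h.
by rewrite rmorphM /= h ?mulr0.
Qed.

End Points.

(** * Polynomials in x_0 over S *)

Section Specialization.
Variables (K : fieldType) (n : nat).
Implicit Types (g : {mpoly K[n.+1]}) (m : 'X_{1..n.+1}) (v : 'rV[K]_n).

Fact x0poly_zmod_morphism : zmod_morphism (@x0poly K n).
Proof. by move=> p q; rewrite /x0poly rmorphB. Qed.

Fact x0poly_monoid_morphism : monoid_morphism (@x0poly K n).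
Proof. by split=> [|p q]; rewrite /x0poly (rmorph1, rmorphM). Qed.

HB.instance Definition _ :=
  GRing.isZmodMorphism.Build _ _ (@x0poly K n) x0poly_zmod_morphism.
HB.instance Definition _ :=
  GRing.isMonoidMorphism.Build _ _ (@x0poly K n) x0poly_monoid_morphism.

Definition mnm_tail m : 'X_{1..n} := [multinom m (lift ord0 j) | j < n].

Definition mnm_cons i (m' : 'X_{1..n}) : 'X_{1..n.+1} :=
  [multinom if unlift ord0 j is Some j' then m' j' else i | j < n.+1].

Lemma mnm_eq_cons m i (m' : 'X_{1..n}) :
  (m == mnm_cons i m') = (m ord0 == i) && (mnm_tail m == m').
Proof.
apply/eqP/andP=> [->|[/eqP<- /eqP<-]].
  split; first by rewrite mnmE unlift_none.
  by apply/eqP/mnmP => j; rewrite !mnmE liftK.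
by apply/mnmP=> j; rewrite mnmE; case: unliftP => [j' ->|-> //]; rewrite mnmE.
Qed.

Lemma x0polyX m : x0poly 'X_[K, m] = ('X_[mnm_tail m])%:P * 'X^(m ord0).
Proof.
rewrite /x0poly mmapX /mmap1 big_ord_recl unlift_none mulrC; congr (_ * _).
rewrite mpolyXE_id rmorph_prod; apply: eq_bigr => j _.
by rewrite liftK rmorphXn mnmE.
Qed.

Lemma x0polyC (c : K) : x0poly (c%:MP_[n.+1]) = (c%:MP_[n])%:P.
Proof. by rewrite /x0poly mmapC. Qed.

Lemma x0polyE g :
  x0poly g = \sum_(m <- msupp g) (g@_m *: 'X_[mnm_tail m])%:P * 'X^(m ord0).
Proof.
rewrite {1}[g]mpolyE rmorph_sum; apply: eq_bigr => m _.
by rewrite -mul_mpolyC rmorphM /= x0polyC x0polyX mulrA -polyCM mul_mpolyC.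
Qed.

(** [x0poly] only regroups monomials; this is what allows degrees, supports and
    homogeneity to be transported between R and S[x_0]. *)
Lemma coef_x0poly g i (m' : 'X_{1..n}) : ((x0poly g)`_i)@_m' = g@_(mnm_cons i m').
Proof.
rewrite x0polyE coef_sum raddf_sum /= [g in RHS]mpolyE raddf_sum /=.
apply: eq_bigr => m _; rewrite mcoeffZ mcoeffX mnm_eq_cons.
rewrite coefCM coefXn mulr_natr mcoeffMn mcoeffZ mcoeffX [i == _]eq_sym.
by case: (_ == i) => /=; rewrite ?mulr1n ?mulr0n ?mulr0.
Qed.

Lemma size_x0polyP g k :
  (size (x0poly g) <= k)%N <-> forall m, m \in msupp g -> (m ord0 < k)%N.
Proof.
split=> [h m|h].
  rewrite mcoeff_msupp; apply: contraNT; rewrite -leqNgt => hk.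
  have /eqP -> : m == mnm_cons (m ord0) (mnm_tail m).
    by rewrite mnm_eq_cons !eqxx.
  by rewrite -coef_x0poly nth_default ?mcoeff0 ?(leq_trans h).
apply/leq_sizeP => j hj; apply/mpolyP => m'; rewrite coef_x0poly mcoeff0.
apply: memN_msupp_eq0; apply/negP => /h; rewrite mnmE unlift_none ltnNge.
by rewrite hj.
Qed.
End Specialization.

(** * Leading coefficients and specialization *)

Section Semicontinuity.
Variables (A : comNzRingType) (K : fieldType) (phi : {rmorphism A -> K}).
Variables (J : {poly A} -> Prop).
Hypothesis idJ : is_ideal J.

Lemma ideal_sum (I : Type) (r : seq I) (E : I -> {poly A}) :
  (forall i, J (E i)) -> J (\sum_(i <- r) E i).
Proof. by case: idJ => J0 JD _ h; elim/big_ind: _ => //; apply: JD. Qed.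

(** Nakayama's lemma in determinant form. If f specializes to degree j, less than
    the degree of the monic f0, then the remainders of f, f x, f x^2 and so on
    modulo f0 specialize to polynomials of degrees j, j+1, ..., deg f0 - 1. Their
    coefficients in these degrees form a square matrix M that is triangular with
    nonzero diagonal after specialization. The combination of the remainders by
    a row of the adjugate of M has coefficient det M in degree j and 0 in the
    higher degrees. *)
Lemma specialized_degree_lift (f0 f : {poly A}) j :
  f0 \is monic -> J f0 -> J f -> size (map_poly phi f) = j.+1 ->
  exists h, [/\ J h, (size h <= j.+1)%N & phi h`_j != 0].
Proof.
move=> mon0 J0 Jf szf; case: (idJ) => _ JD JM.
have nz0 := monic_neq0 mon0.
have nzf : map_poly phi f != 0 by rewrite -size_poly_eq0 szf.
have sz0 : size (map_poly phi f0) = size f0.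
  by rewrite size_map_poly_id0 // (monicP mon0) rmorph1 oner_neq0.
case: (ltnP j.+1 (size f0)) => [lt_j|le_j]; last first.
  (* If j is at least deg f0, a shift of the monic element does it. *)
  exists ('X^(j.+1 - size f0) * f0); split; first exact: JM.
    by rewrite mulrC size_mulXn // subnK.
  rewrite coefXnM; have s0 : (0 < size f0)%N by rewrite lt0n size_poly_eq0.
  rewrite ifN; last by rewrite -leqNgt leq_subLR addnC -leq_subLR subSnn.
  have -> : (j - (j.+1 - size f0) = (size f0).-1)%N.
    by rewrite -(prednK s0) subSS subKn // -ltnS prednK.
  by move: (monicP mon0); rewrite lead_coefE => ->; rewrite rmorph1 oner_neq0.
pose N := ((size f0).-1 - j).-1.
have eN : (size f0 = (j + N.+1).+1)%N.
  have h : (j < (size f0).-1)%N by rewrite -ltnS prednK // (ltn_trans _ lt_j).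
  by rewrite /N prednK ?subn_gt0 // subnKC ?(ltnW h) // prednK // (ltn_trans _ lt_j).
pose p i := Pdiv.CommonRing.rmodp (f * 'X^i) f0.
pose q i := Pdiv.CommonRing.rdivp (f * 'X^i) f0.
have pE i : p i = f * 'X^i - q i * f0.
  by rewrite {1}(Pdiv.RingMonic.rdivp_eq mon0 (f * 'X^i)) addrC addKr.
have Jp i : J (p i).
  by rewrite pE -mulNr; apply: JD; [rewrite mulrC|]; apply: JM.
have szp i : (size (p i) <= j + N.+1)%N.
  by rewrite -ltnS -eN Pdiv.CommonRing.ltn_rmodp.
(* The specialized f x^i already has degree below that of f0, so reduction
   modulo f0 does not change it. *)
have phip i : (i <= N)%N -> map_poly phi (p i) = map_poly phi f * 'X^i.
  move=> le_i; rewrite pE rmorphB !rmorphM /= map_polyXn.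
  have [->|qn0] := eqVneq (map_poly phi (q i)) 0; first by rewrite mul0r subr0.
  have : (size (map_poly phi (q i) * map_poly phi f0)%R <= j + N.+1)%N.
    have -> : map_poly phi (q i) * map_poly phi f0 =
       map_poly phi f * 'X^i - map_poly phi (p i).
      by rewrite pE rmorphB !rmorphM /= map_polyXn subKr.
    rewrite (leq_trans (size_polyD _ _)) // size_polyN geq_max.
    rewrite (leq_trans (size_poly _ _)) ?szp // andbT.
    by rewrite size_mulXn // szf addnS -addSn addnC leq_add2l.
  rewrite size_Mmonic ?monic_map // sz0 eN /= leqNgt => /negP[].
  by rewrite [X in X.-1]addnS /= -[ltnLHS]add0n ltn_add2r size_poly_gt0.
pose M := \matrix_(i < N.+1, l < N.+1) (p i)`_(j + l).
pose h := \sum_(i < N.+1) (\adj M ord0 i)%:P * p i.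
have hE (l : 'I_N.+1) : h`_(j + l) = (\det M)%:M ord0 l.
  rewrite -mul_adj_mx mxE coef_sum; apply: eq_bigr => i _.
  by rewrite coefCM; congr (_ * _); rewrite [RHS]mxE.
exists h; split.
- by apply: ideal_sum => i; apply: JM.
- apply/leq_sizeP => l le_l; case: (leqP (j + N.+1) l) => [le_l'|lt_l].
    rewrite coef_sum big1 // => i _.
    by rewrite coefCM nth_default ?mulr0 // (leq_trans (szp i)).
  have lt_lN : (l - j < N.+1)%N by rewrite ltn_subLR // (leq_trans _ le_l).
  have := hE (Ordinal lt_lN); rewrite /= subnKC; last by rewrite ltnW.
  move->; rewrite mxE; case: eqP => // /(congr1 val) /= /esym/eqP.
  by rewrite subn_eq0 leqNgt le_l.
- have := hE ord0; rewrite /= addn0 => ->; rewrite mxE eqxx mulr1n.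
  rewrite -det_map_mx det_trig.
    rewrite prodf_seq_neq0; apply/allP => i _; rewrite !mxE /=.
    rewrite -coef_map /= phip -1?ltnS // coefMXn ifN; last first.
      by rewrite -leqNgt leq_addl.
    by rewrite addnK -[j]/(j.+1.-1) -szf -lead_coefE lead_coef_eq0 -size_poly_eq0 szf.
  apply/is_trig_mxP => i l lt_il; rewrite !mxE -coef_map /= phip -1?ltnS //.
  rewrite coefMXn ifN; last by rewrite -leqNgt (leq_trans (ltnW lt_il)) ?leq_addl.
  rewrite nth_default // szf -addnBA ?(ltnW lt_il) // -addn1 leq_add2l.
  by rewrite subn_gt0.
Qed.
End Semicontinuity.

(** A predicate in Prop gives no way to compute the generator, hence the
    classical descent on the degree of a nonzero element. *)
Lemma poly_ideal_principal (K : fieldType) (J : {poly K} -> Prop) f :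
  is_ideal J -> J f -> f != 0 ->
  exists u, [/\ u \is monic, J u & forall g, J g -> u %| g].
Proof.
case=> _ JD JM; have [n] := ubnP (size f).
elim: n f => // n IH f le_n Jf fn0.
case: (classic (exists2 g, J g & ~~ (f %| g))) => [[g Jg ndvd]|h].
  apply: (IH (g %% f)) => //.
  - by rewrite (leq_trans (ltn_modpN0 g fn0)) // -ltnS.
  - have -> : g %% f = g + (- (g %/ f)) * f.
      by rewrite {2}(divp_eq g f) mulNr addrAC subrr add0r.
    by apply: JD => //; apply: JM.
exists ((lead_coef f)^-1 *: f); split.
- by rewrite monicE lead_coefZ mulVf ?lead_coef_eq0.
- by rewrite -mul_polyC; apply: JM.
- move=> g Jg; rewrite dvdpZl ?invr_eq0 ?lead_coef_eq0 //.
  by apply: contraT => ndvd; case: h; exists g.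
Qed.

(** * Restriction to a line through the centre *)

Section FiberPolynomial.
Variables (K : fieldType) (n : nat).
Implicit Types (g : {mpoly K[n.+1]}) (v : 'rV[K]_n).

(** Restriction to the line joining the centre to v, in the affine coordinate x_0
    that misses only the centre. *)
Definition fiber_poly v : {mpoly K[n.+1]} -> {poly K} :=
  map_poly (meval (fun i => v 0 i)) \o @x0poly K n.

HB.instance Definition _ v := GRing.RMorphism.copy (fiber_poly v)
  (map_poly (meval (fun i => v 0 i)) \o @x0poly K n).

Lemma coef_fiber_poly v g i :
  (fiber_poly v g)`_i = ((x0poly g)`_i).@[fun i => v 0 i].
Proof. by rewrite coef_map. Qed.

Lemma size_fiber_poly v g : (size (fiber_poly v g) <= size (x0poly g))%N.
Proof. exact: size_poly. Qed.

Lemma fiber_polyC v (c : K) : fiber_poly v c%:MP_[n.+1] = c%:P.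
Proof. by rewrite /fiber_poly /= x0polyC map_polyC /= mevalC. Qed.

Lemma fiber_polyX v (m : 'X_{1..n.+1}) :
  fiber_poly v 'X_[K, m] =
  ('X_[K, mnm_tail m].@[fun i => v 0 i])%:P * 'X^(m ord0).
Proof. by rewrite /fiber_poly /= x0polyX rmorphM /= map_polyC /= map_polyXn. Qed.

Lemma horner_fiber_poly v g a :
  (fiber_poly v g).[a] =
  g.@[fun i => if unlift ord0 i is Some j then v 0 j else a].
Proof.
rewrite {1}[g]mpolyE rmorph_sum horner_sum mevalE; apply: eq_bigr => m _.
rewrite -mul_mpolyC rmorphM /= fiber_polyC fiber_polyX hornerM hornerC.
congr (_ * _); rewrite hornerM hornerC hornerXn big_ord_recl unlift_none mulrC.
congr (_ * _); rewrite mevalX; apply: eq_bigr => j _.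
by rewrite liftK mnmE.
Qed.

(** Needed to see that the images of I in S[x_0] and in K[x_0] are ideals. *)
Lemma x0poly_surj p : exists g, @x0poly K n g = p.
Proof.
exists (\sum_(i < size p) \sum_(m <- msupp p`_i) p`_i@_m *: 'X_[mnm_cons i m]).
rewrite rmorph_sum -[RHS]coefK poly_def; apply: eq_bigr => i _.
rewrite rmorph_sum -mul_polyC [in RHS](mpolyE p`_i) rmorph_sum big_distrl /=.
apply: eq_bigr => m _; rewrite -!mul_mpolyC rmorphM /= x0polyC x0polyX.
have /andP[/eqP-> /eqP->] :
  (mnm_cons i m ord0 == i) && (mnm_tail (mnm_cons i m) == m).
  by rewrite -mnm_eq_cons.
by rewrite mulrA -polyCM.
Qed.

Lemma mdeg_cons i (m : 'X_{1..n}) : mdeg (mnm_cons i m) = (i + mdeg m)%N.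
Proof.
rewrite !mdegE big_ord_recl mnmE unlift_none; congr (_ + _)%N.
by apply: eq_bigr => j _; rewrite mnmE liftK.
Qed.

Lemma coef_x0poly_homog d g i :
  g \is d.-homog -> (i <= d)%N -> (x0poly g)`_i \is (d - i).-homog.
Proof.
move=> /dhomogP hg le_i; apply/dhomogP => m; rewrite mcoeff_msupp coef_x0poly.
by rewrite -mcoeff_msupp => /hg /=; rewrite mdeg_cons => <-; rewrite addKn.
Qed.

Lemma size_x0poly_homog d g : g \is d.-homog -> (size (x0poly g) <= d.+1)%N.
Proof.
move=> /dhomogP hg; apply/size_x0polyP => m /hg /= <-.
by rewrite ltnS mdegE big_ord_recl leq_addr.
Qed.

(** The coefficient of x_0^i is homogeneous of degree d - i. The powers of c are
    on both sides so that nothing is said of d - i when i > d. *)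
Lemma fiber_poly_scale d g v c i : g \is d.-homog ->
  c ^+ i * (fiber_poly (c *: v) g)`_i = c ^+ d * (fiber_poly v g)`_i.
Proof.
move=> hg; rewrite !coef_fiber_poly; case: (leqP i d) => [le_i|lt_i].
  rewrite -(meval_eq (v1 := fun j => c * v 0 j)); last by move=> j; rewrite mxE.
  rewrite (dhomog_scale _ _ (coef_x0poly_homog hg le_i)) mulrA -exprD.
  by rewrite subnKC.
rewrite nth_default ?meval0 ?mulr0 //.
by rewrite (leq_trans (size_x0poly_homog hg)).
Qed.

Lemma lead_coef_x0poly_homog d g : g \is d.-homog ->
  exists d', lead_coef (x0poly g) \is d'.-homog.
Proof.
move=> hg; exists (d - (size (x0poly g)).-1)%N; rewrite lead_coefE.
apply: coef_x0poly_homog => //; move: (size_x0poly_homog hg).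
by case: (size _).
Qed.

Variables (I : {mpoly K[n.+1]} -> Prop).
Hypothesis satI : saturated_homogeneous_ideal I.

Lemma x0poly_ideal : is_ideal (fun p => exists2 g, I g & x0poly g = p).
Proof.
case: satI => -[I0 ID IM] _ _; split; first by exists 0; rewrite ?rmorph0.
  by move=> _ _ [g Ig <-] [h Ih <-]; exists (g + h); rewrite ?rmorphD //; apply: ID.
move=> r _ [g Ig <-]; have [s <-] := x0poly_surj r.
by exists (s * g); [apply: IM | rewrite rmorphM].
Qed.

Lemma fiber_poly_ideal v : is_ideal (fun p => exists2 g, I g & fiber_poly v g = p).
Proof.
case: satI => -[I0 ID IM] _ _; split; first by exists 0; rewrite ?rmorph0.
  by move=> _ _ [g Ig <-] [h Ih <-]; exists (g + h); rewrite ?rmorphD //; apply: ID.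
move=> r _ [g Ig <-].
have [s es] := x0poly_surj (map_poly (@mpolyC n K) r).
exists (s * g); first exact: IM.
rewrite rmorphM /=; congr (_ * _); apply/polyP => i.
by rewrite coef_fiber_poly es coef_map /= mevalC.
Qed.

Hypothesis pNZ : ~ closed_point_of I (center K n).

(** The centre is not a zero of I, so some homogeneous element of I, of degree d
    say, has a nonzero value at the centre; this value is its coefficient of
    x_0^d, and no higher power of x_0 can occur. *)
Lemma monic_mem : exists d g,
  [/\ I g, g \is d.-homog, x0poly g \is monic & size (x0poly g) = d.+1].
Proof.
case: (satI) => -[I0 ID IM] IH _.
have [f [d [If nz]]] : exists f d, I f /\
    (pihomog mdeg d f).@[fun i => center K n 0 i] != 0.
  apply: NNPP => h; apply: pNZ; split.
    apply/eqP => /rowP /(_ ord0); rewrite !mxE !eqxx /= => /eqP.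
    by rewrite oner_eq0.
  move=> f If d; apply/eqP; apply/negPn/negP => nz.
  by apply: h; exists f, d.
pose g := pihomog mdeg d f; have hg : g \is d.-homog := pihomogP _ _ _.
have hgP m : m \in msupp g -> mdeg m = d by move/dhomogP: (hg) => h /h.
have Ig : I g by apply: IH.
pose c := g@_(mnm_cons d 0).
have nzc : c != 0.
  apply: contraNneq nz => c0; rewrite mevalE big1_seq // => m /andP[_ hm].
  have [e|ne] := eqVneq m (mnm_cons d 0); first by rewrite e -/c c0 mul0r.
  suff [j jn] : exists j, m (lift ord0 j) != 0%N.
    rewrite (bigD1 (lift ord0 j)) //= mxE /= expr0n (negPf jn) mul0r.
    by rewrite mulr0.
  apply/existsP; apply: contraNT ne => /existsPn h0.
  have t0 : mnm_tail m = 0%MM.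
    by apply/mnmP => j; rewrite mnmE mnm0E; apply/eqP/negPn/h0.
  rewrite mnm_eq_cons t0 eqxx andbT.
  rewrite -(hgP _ hm); apply/eqP.
  have /eqP -> : m == mnm_cons (m ord0) (mnm_tail m).
    by rewrite mnm_eq_cons !eqxx.
  by rewrite mdeg_cons t0 mdeg0 addn0 mnmE unlift_none.
have cd : (x0poly (c^-1 *: g))`_d = 1.
  rewrite -mul_mpolyC rmorphM /= x0polyC coefCM; apply/mpolyP => m.
  rewrite mcoeffCM coef_x0poly mcoeff1; have [->|nm] := eqVneq m 0%MM.
    by rewrite mulVf.
  rewrite memN_msupp_eq0 ?mulr0 //; apply/negP => /hgP.
  rewrite mdeg_cons -[RHS]addn0 => /eqP; rewrite eqn_add2l mdeg_eq0.
  exact/negP.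
have hcg : c^-1 *: g \is d.-homog by exact: dhomogZ.
have sz : size (x0poly (c^-1 *: g)) = d.+1.
  apply/eqP; rewrite eqn_leq size_x0poly_homog //= ltnNge.
  by apply/negP => /leq_sizeP /(_ d (leqnn _)) /eqP; rewrite cd oner_eq0.
exists d, (c^-1 *: g); split=> //.
- by rewrite -mul_mpolyC; apply: IM.
- by rewrite monicE lead_coefE sz cd.
Qed.

(** Passing to a homogeneous component keeps the bound on the x_0-degree, and the
    coefficient of x_0^j in some component does not vanish at v. *)
Lemma homog_specialized_degree_lift v f j : I f ->
  size (fiber_poly v f) = j.+1 ->
  exists d h, [/\ I h, h \is d.-homog, (size (x0poly h) <= j.+1)%N
                & (fiber_poly v h)`_j != 0].
Proof.
move=> If sz; have [d [g [Ig _ mon _]]] := monic_mem.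
have [] := specialized_degree_lift x0poly_ideal mon _ _ sz.
- by exists g.
- by exists f.
move=> _ [[h Ih <-] szh nz].
case: (satI) => _ IH _; apply: NNPP => no; case/negP: nz; apply/eqP.
rewrite (pihomog_partitionE (leqnn (msize h))) rmorph_sum coef_sum rmorph_sum /=.
apply: big1 => b _; apply/eqP/negPn/negP => nz.
apply: no; exists b, (pihomog mdeg b h); split.
- exact: IH.
- exact: pihomogP.
- apply/size_x0polyP => m; move/size_x0polyP: szh => szh hm; apply: szh.
  move: hm; rewrite !mcoeff_msupp; apply: contraNneq => h0.
  rewrite pihomogE raddf_sum /= big1 // => m1 _.
  rewrite mcoeffZ mcoeffX; case: eqP => [->|_]; last by rewrite mulr0.
  by rewrite h0 mul0r.
- by rewrite coef_fiber_poly.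
Qed.
End FiberPolynomial.

(** * Leading coefficients of a Groebner basis *)

Section EliminationGroebner.
Variables (K : fieldType) (n : nat).
Variables (le : rel 'X_{1..n.+1}).
Hypothesis leP : elimination_ordering le.
Implicit Types (g h : {mpoly K[n.+1]}) (m : 'X_{1..n.+1}).

(** Only monomials free of x_0 are compared in the hypothesis; dividing both
    monomials by the smaller power of x_0 reduces to that case. *)
Lemma elimination_le_x0 m1 m2 : le m1 m2 -> (m1 ord0 <= m2 ord0)%N.
Proof.
case: leP => -[tot anti tr add _] elim le12; rewrite leqNgt; apply/negP => lt21.
pose b := mnm_cons (m2 ord0) (0 : 'X_{1..n})%MM.
have bE m : (m2 ord0 <= m ord0)%N -> (b <= m)%MM.
  move=> h; apply/mnm_lepP => j; rewrite mnmE.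
  by case: unliftP => [j' ->|-> //]; rewrite mnm0E.
have b0 : b ord0 = m2 ord0 by rewrite mnmE unlift_none.
have [] := elim (m1 - b)%MM (m2 - b)%MM.
- by rewrite mnmBE b0 subn_gt0.
- by rewrite mnmBE b0 subnn.
move=> h _; have := add _ _ b h; rewrite !submK ?bE // 1?ltnW // => le21.
have := anti m1 m2; rewrite le12 le21 => /(_ isT) e.
by rewrite e ltnn in lt21.
Qed.

Definition leading_mono (f : {mpoly K[n.+1]}) m :=
  m \in msupp f /\ forall m1, m1 \in msupp f -> le m1 m.

Lemma leading_mono_exists f : f != 0 -> exists m, leading_mono f m.
Proof.
case: leP => -[tot _ tr _ _] _; rewrite -msupp_eq0 /leading_mono.
elim: (msupp f) => // m1 [|m2 s] IH _.
  by exists m1; split=> [|m]; rewrite inE ?eqxx // => /eqP->; case/orP: (tot m1 m1).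
have [//|m [hm max]] := IH.
case/orP: (tot m1 m) => h.
  exists m; split=> [|m']; rewrite inE ?hm ?orbT // => /predU1P[->//|]; exact: max.
exists m1; split=> [|m']; rewrite inE ?eqxx // => /predU1P[->|/max h'].
  by case/orP: (tot m1 m1).
exact: tr h' h.
Qed.

Lemma size_x0poly_lead g m : leading_mono g m -> size (x0poly g) = (m ord0).+1.
Proof.
case=> hm max; apply/eqP; rewrite eqn_leq; apply/andP; split.
  by apply/size_x0polyP => m1 /max /elimination_le_x0.
by rewrite ltnNge; apply/negP => /size_x0polyP /(_ _ hm); rewrite ltnn.
Qed.

Variables (I : {mpoly K[n.+1]} -> Prop) (G : seq {mpoly K[n.+1]}).
Hypothesis satI : saturated_homogeneous_ideal I.
Hypothesis homG : forall g, g \in G -> g \is ishomog mdeg.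
Hypothesis GP : groebner_basis le I G.

(** The leading term of f is a combination of the leading terms of G, and a
    monomial occurring in a combination of terms is a multiple of one of them. *)
Lemma groebner_divides f m : I f -> leading_mono f m ->
  exists g mg, [/\ g \in G, leading_mono g mg & (mg <= m)%MM].
Proof.
move=> If [hm max]; case: GP => _ lt_eq.
have /lt_eq [s [hs e]] : leading_ideal le I (f@_m *: 'X_[m]).
  apply: ideal_gen_id; exists f; split=> //; exists m; split=> //.
have : (f@_m *: 'X_[m])@_m != 0.
  by rewrite mcoeffZ mcoeffX eqxx mulr1 -mcoeff_msupp.
rewrite e raddf_sum /= => nz; apply: NNPP => no; case/negP: nz.
rewrite big1_seq //= => u /hs [g [Gg [mg [hmg maxg eu]]]].
rewrite eu -scalerAr mcoeffZ; have [le_m|nle] := boolP (mg <= m)%MM.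
  by case: no; exists g, mg; split.
rewrite [X in _ * X]memN_msupp_eq0 ?mulr0 // (perm_mem (msuppMX _ _)).
apply/mapP => -[m' _ e']; case/negP: nle; rewrite e'; exact: lem_addr.
Qed.

(** Division with remainder: the leading term of h is cancelled by a multiple of
    some g in G, of x_0-degree at most k because the ordering compares
    x_0-degrees first. This changes the coefficient of x_0^k by a multiple of
    the leading coefficient of g. Since h is homogeneous, only the finitely many
    monomials of degree d matter, and the induction is on their number below the
    leading one. *)
Lemma leading_coefs_vanish (v : 'rV[K]_n) k :
  (forall g, g \in G -> (size (x0poly g) <= k.+1)%N ->
     (lead_coef (x0poly g)).@[fun i => v 0 i] = 0) ->
  forall d h, I h -> h \is d.-homog -> (size (x0poly h) <= k.+1)%N ->
  (fiber_poly v h)`_k = 0.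
Proof.
move=> van d h; case: (leP) => -[tot anti tr add _] elim.
case: (satI) => -[I0 ID IM] _ _.
(* the bound d + 1 only serves to make the set of monomials a finite type *)
pose below m := #|[pred m' : 'X_{1..n.+1 < d.+1} | le m' m]|.
have [N] : exists N, forall m, leading_mono h m -> (below m < N)%N.
  exists #|{: 'X_{1..n.+1 < d.+1}}|.+1 => m _; rewrite ltnS; exact: max_card.
elim: N h => [|N IH] h hN Ih homh szh.
  have [->|/leading_mono_exists[m /hN //]] := eqVneq h 0.
  by rewrite rmorph0 coef0.
have [->|/leading_mono_exists[m hm]] := eqVneq h 0.
  by rewrite rmorph0 coef0.
have szm := size_x0poly_lead hm.
move: szh; rewrite szm ltnS leq_eqVlt => /predU1P[mk|lt_mk]; last first.
  by rewrite nth_default // (leq_trans (size_fiber_poly _ _)) // szm.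
have [g [mg [Gg hmg le_mg]]] := groebner_divides Ih hm.
have szg := size_x0poly_lead hmg.
have Ig : I g by case: GP => h' _; apply: h'.
have le_mg0 : (mg ord0 <= k)%N by rewrite -mk; move/mnm_lepP: le_mg.
have nzg : g@_mg != 0 by case: hmg; rewrite mcoeff_msupp.
pose q := (h@_m / g@_mg) *: 'X_[m - mg].
pose h' := h - q * g.
have homq : q * g \is d.-homog.
  have [dg homg] := homogP _ _ (homG Gg).
  have edg : mdeg mg = dg by case: hmg => hm' _; move/dhomogP: homg; apply.
  have edm : mdeg m = d by case: hm => hm' _; move/dhomogP: homh; apply.
  have -> : d = (mdeg (m - mg) + dg)%N.
    by rewrite -edg -mdegD submK.
  by apply: dhomogM => //; apply: dhomogZ; rewrite dhomogX.
have supq m1 : m1 \in msupp (q * g) -> le m1 m.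
  rewrite /q -scalerAl ['X_[_] * g]mulrC => /msuppZ_le.
  rewrite (perm_mem (msuppMX _ _)).
  case/mapP=> m2 hm2 ->; case: hmg => _ /(_ _ hm2) h2.
  by have := add _ _ (m - mg)%MM h2; rewrite [(mg + _)%MM]addmC submK // addmC.
have suph' m1 : m1 \in msupp h' -> le m1 m.
  move=> /msuppB_le; rewrite mem_cat => /orP[|/supq //].
  by case: hm => _ max /max.
have coefq : (q * g)@_m = h@_m.
  rewrite /q -scalerAl mcoeffZ ['X_[_] * g]mulrC -{2}(submK le_mg).
  by rewrite mcoeffMX divfK.
have nm : m \notin msupp h'.
  by rewrite mcoeff_msupp negbK mcoeffB coefq subrr.
have hh' : (fiber_poly v h')`_k = 0.
  apply: IH.
  - move=> m' hm'; have lt' : le m' m by case: hm' => hm' _; apply: suph'.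
    have ne : ~~ le m m'.
      apply: contraNN nm => gt'; have /anti -> : le m m' && le m' m by rewrite gt'.
      by case: hm'.
    rewrite -ltnS; apply: leq_trans (hN _ hm); rewrite ltnS.
    apply: proper_card; apply/properP; split.
      apply/subsetP => x; rewrite !inE => hx; exact: tr hx lt'.
    have bm : (mdeg m < d.+1)%N.
      by rewrite ltnS; case: hm => h1 _; move/dhomogP: homh => /(_ _ h1) /= ->.
    exists (BMultinom bm); rewrite !inE //=.
    by case/orP: (tot m m).
  - by rewrite /h' -mulNr; apply: ID => //; apply: IM.
  - by apply: rpredB.
  - apply/size_x0polyP => m1 /suph' /elimination_le_x0; by rewrite mk ltnS.
move: hh'; rewrite /h' rmorphB coefB => /eqP; rewrite subr_eq0 => /eqP ->.
rewrite rmorphM.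
rewrite /q -mul_mpolyC rmorphM /= fiber_polyC fiber_polyX -!mulrA !coefCM.
rewrite ['X^_ * _]mulrC coefMXn mnmBE mk ltnNge leq_subr /= subKn //.
have := van _ Gg; rewrite szg ltnS => /(_ le_mg0).
by rewrite lead_coefE szg /= coef_fiber_poly => ->; rewrite !mulr0.
Qed.
End EliminationGroebner.

(** * Binary forms *)

Section Homogenization.
Variable K : fieldType.
Implicit Types (p w : {poly K}) (r c : K).

(** For p of degree larger than d this drops coefficients; every use bounds the
    size of p by d + 1. *)
Definition homogenize d p : {mpoly K[2]} :=
  \sum_(i < d.+1) p`_i *: ('X_0 ^+ i * 'X_1 ^+ (d - i)).

Definition dehomogenize : {mpoly K[2]} -> {poly K} :=
  mmap (@polyC K) (fun i : 'I_2 => if i == 0 then 'X else 1).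

HB.instance Definition _ := GRing.RMorphism.copy dehomogenize
  (mmap (@polyC K) (fun i : 'I_2 => if i == 0 then 'X else 1)).

Lemma dehomogenizeC c : dehomogenize c%:MP_[2] = c%:P.
Proof. exact: mmapC. Qed.

Lemma dehomogenizeX (i : 'I_2) :
  dehomogenize 'X_i = if i == 0 then 'X else 1.
Proof. by rewrite /dehomogenize mmapX mmap1U. Qed.

Fact homogenize_linear d : linear (homogenize d).
Proof.
move=> c p q; rewrite /homogenize scaler_sumr -big_split; apply: eq_bigr => i _.
by rewrite coefD coefZ scalerDl scalerA.
Qed.

HB.instance Definition _ d :=
  GRing.isLinear.Build K {poly K} {mpoly K[2]} _ (homogenize d)
    (homogenize_linear d).

Lemma homogenizeXn d i : (i <= d)%N ->
  homogenize d 'X^i = 'X_0 ^+ i * 'X_1 ^+ (d - i).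
Proof.
move=> le_i; rewrite /homogenize (bigD1 (Ordinal (le_i : i < d.+1)%N)) //=.
rewrite coefXn eqxx scale1r big1 ?addr0 // => j ne; rewrite coefXn.
by case: eqP => [e|_]; [case/eqP: ne; apply: val_inj | rewrite scale0r].
Qed.

Lemma homogenize_mulX d p : homogenize d.+1 ('X * p) = 'X_0 * homogenize d p.
Proof.
rewrite /homogenize big_ord_recl coefXM scale0r add0r mulr_sumr.
apply: eq_bigr => i _; rewrite coefXM /= subSS -scalerAr.
by rewrite exprS mulrA.
Qed.

(** Raising the nominal degree adds a zero at (1 : 0). *)
Lemma homogenize_degS d p : (size p <= d.+1)%N ->
  homogenize d.+1 p = 'X_1 * homogenize d p.
Proof.
move=> sz; rewrite /homogenize big_ord_recr /= nth_default // scale0r addr0.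
rewrite mulr_sumr; apply: eq_bigr => i _ /=.
by rewrite subSn -1?ltnS // exprS -scalerAr mulrCA.
Qed.

Lemma homogenize_mulXsubC d r w : (size w <= d.+1)%N ->
  homogenize d.+1 (('X - r%:P) * w) = ('X_0 - r *: 'X_1) * homogenize d w.
Proof.
move=> sz; rewrite mulrBl mul_polyC linearB linearZ /= homogenize_mulX.
by rewrite homogenize_degS // mulrBl -scalerAl.
Qed.

Lemma homogenize_exp d r w e : (size w <= d.+1)%N ->
  homogenize (e + d) (('X - r%:P) ^+ e * w) =
  ('X_0 - r *: 'X_1) ^+ e * homogenize d w.
Proof.
move=> sz; elim: e => [|e IH]; first by rewrite !mul1r.
rewrite !exprS -!mulrA addSn homogenize_mulXsubC ?IH //.
rewrite (leq_trans (size_polyMleq _ _)) // size_exp_XsubC addSn /=.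
by rewrite -addnS leq_add2l.
Qed.

Section PowerProducts.
Variables (I : Type) (r : I -> K) (e : I -> nat).

Lemma monic_prod_XsubC_exp (s : seq I) :
  \prod_(i <- s) ('X - (r i)%:P) ^+ e i \is monic.
Proof. by apply: monic_prod => i _; rewrite monic_exp ?monicXsubC. Qed.

Lemma size_prod_XsubC_exp (s : seq I) :
  size (\prod_(i <- s) ('X - (r i)%:P) ^+ e i) = (\sum_(i <- s) e i).+1.
Proof.
elim: s => [|i s IH]; first by rewrite !big_nil size_poly1.
rewrite !big_cons size_Mmonic ?monic_prod_XsubC_exp ?IH //; last first.
  by rewrite monic_neq0 ?monic_exp ?monicXsubC.
by rewrite size_exp_XsubC addnS.
Qed.

Lemma mup_prod_XsubC_exp (s : seq I) x :
  mup x (\prod_(i <- s) ('X - (r i)%:P) ^+ e i) =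
  (\sum_(i <- s | r i == x) e i)%N.
Proof.
elim: s => [|i s IH]; first by rewrite !big_nil mupNroot // root1.
rewrite !big_cons mupM ?mup_XsubCX ?IH; first by case: ifP.
  by rewrite monic_neq0 ?monic_exp ?monicXsubC.
by rewrite monic_neq0 ?monic_prod_XsubC_exp.
Qed.

Lemma homogenize_prod (s : seq I) :
  homogenize (\sum_(i <- s) e i) (\prod_(i <- s) ('X - (r i)%:P) ^+ e i) =
  \prod_(i <- s) ('X_0 - r i *: 'X_1) ^+ e i.
Proof.
elim: s => [|i s IH].
  by rewrite !big_nil -(expr0 'X) homogenizeXn // !expr0 mul1r.
by rewrite !big_cons homogenize_exp ?IH // size_prod_XsubC_exp.
Qed.
End PowerProducts.

(** The value at the point (1 : 0), which corresponds to the centre. *)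
Lemma meval_homogenize d p (w : 'I_2 -> K) : w 0 = 1 -> w 1 = 0 ->
  (homogenize d p).@[w] = p`_d.
Proof.
move=> w0 w1; rewrite /homogenize rmorph_sum big_ord_recr /= big1 ?add0r.
  rewrite mevalZ mevalM subnn expr0 meval1 mulr1 rmorphXn /= mevalXU w0.
  by rewrite expr1n mulr1.
move=> i _; rewrite mevalZ mevalM rmorphXn /= [X in _ * (_ * X)]rmorphXn /= !mevalXU.
by rewrite w1 expr0n subn_eq0 leqNgt ltn_ord !mulr0.
Qed.

Lemma restrict_line_homog n d (v : 'rV[K]_n) (g : {mpoly K[n.+1]}) :
  g \is d.-homog -> restrict_line v g = homogenize d (fiber_poly v g).
Proof.
move/dhomogP => hg; rewrite {1 2}[g]mpolyE /restrict_line !rmorph_sum linear_sum.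
apply: eq_big_seq => m hm /=.
rewrite -mul_mpolyC !rmorphM /= comp_mpolyC fiber_polyC mul_mpolyC.
rewrite mul_polyC linearZ; congr (_ *: _).
rewrite fiber_polyX mul_polyC linearZ /= homogenizeXn; last first.
  by rewrite -(hg _ hm) /= mdegE big_ord_recl leq_addr.
rewrite comp_mpolyX big_ord_recl tnth_mktuple unlift_none scalerAr; congr (_ * _).
rewrite -(hg _ hm) /= mdegE big_ord_recl addKn -prodrXr mevalX -scaler_prod.
apply: eq_bigr => j _.
by rewrite tnth_mktuple liftK exprZn mnmE.
Qed.

Lemma dehomogenize_restrict n (v : 'rV[K]_n) (g : {mpoly K[n.+1]}) :
  dehomogenize (restrict_line v g) = fiber_poly v g.
Proof.
rewrite [g]mpolyE /restrict_line (raddf_sum (comp_mpoly _)) !raddf_sum /=.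
apply: eq_bigr => m _.
rewrite -mul_mpolyC !rmorphM /= comp_mpolyC fiber_polyC /dehomogenize mmapC.
congr (_ * _); rewrite fiber_polyX comp_mpolyX rmorph_prod big_ord_recl mulrC.
rewrite tnth_mktuple unlift_none rmorphXn /= mmapX mmap1U /=; congr (_ * _).
rewrite mevalX rmorph_prod; apply: eq_bigr => j _.
rewrite tnth_mktuple liftK rmorphXn /= mmapZ mmapX mmap1U /= mulr1 mnmE.
by rewrite rmorphXn.
Qed.
End Homogenization.

(** * Fibers as divisors *)

Section FiberDivisor.
Variables (K : closedFieldType) (n : nat).
Variables (I : {mpoly K[n.+1]} -> Prop).
Hypothesis satI : saturated_homogeneous_ideal I.
Hypothesis pNZ : ~ closed_point_of I (center K n).
Implicit Types (g : {mpoly K[n.+1]}) (v : 'rV[K]_n) (a : 'rV[K]_2) (u : {poly K}).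

(** u generates the ideal of the fiber in the affine chart that misses the
    centre. *)
Definition fiber_equation v u :=
  [/\ u \is monic, forall g, I g -> u %| fiber_poly v g
    & exists2 g, I g & fiber_poly v g = u].

Lemma fiber_equation_exists v : exists u, fiber_equation v u.
Proof.
have [d [g [Ig _ mon _]]] := monic_mem satI pNZ.
have [] := poly_ideal_principal (fiber_poly_ideal satI v) (f := fiber_poly v g).
- by exists g.
- by apply: monic_neq0; apply: monic_map.
move=> u [monu [h Ih hu] dvd]; exists u; split=> //; last by exists h.
by move=> f If; apply: dvd; exists f.
Qed.

Lemma mult_at_unique (J : {mpoly K[2]} -> Prop) a r1 r2 :
  mult_at J a r1 -> mult_at J a r2 -> r1 = r2.
Proof.
wlog le12 : r1 r2 / (r1 <= r2)%N.
  by move=> W h1 h2; case/orP: (leq_total r1 r2) => h; [|symmetry]; apply: W.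
move=> [_ n1] [d2 _]; apply/eqP; rewrite eqn_leq le12 leqNgt.
apply/negP => lt12; apply: n1 => f /d2 [h ->].
set L := (X in X ^+ r2).
by exists (h * L ^+ (r2 - r1.+1)); rewrite -mulrA -exprD subnK.
Qed.

(** The multiplicity at the point a of the homogenisation of u to degree deg u:
    the point (1 : 0) is never a zero. *)
Definition root_mult u a : nat :=
  if a 0 1 == 0 then 0%N else mup (a 0 0 / a 0 1) u.

(** The elements of the fiber ideal are not homogeneous, so divisibility is checked
    on the components of degree d, which are the homogenisations of multiples of
    u. Multiplicities are not larger because u itself comes from an element of I,
    and, at the centre, because of the element of I that is monic in x_0. *)
Lemma fiber_mult v u a : fiber_equation v u -> a != 0 ->
  mult_at (fiber_ideal I v) a (root_mult u a).
Proof.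
case=> monu dvd [g0 Ig0 eu] a0; rewrite /root_mult /mult_at.
case: (satI) => -[I0 ID IM] IH _.
set L : {mpoly K[2]} := a 0 1 *: 'X_0 - a 0 0 *: 'X_1.
case: eqP => [a1|/eqP a1].
  split=> [f _|]; first by exists f; rewrite expr0 mulr1.
  have [d [g [Ig hg mon szg]]] := monic_mem satI pNZ.
  move=> /(_ (restrict_line v g)) [|h e]; first by exists g.
  pose w (i : 'I_2) : K := (i == 0)%:R.
  have := congr1 (meval w) e.
  rewrite (restrict_line_homog v hg) meval_homogenize // mevalM expr1.
  rewrite mevalB !mevalZ !mevalXU a1 mul0r mulr0 subrr mulr0.
  rewrite coef_fiber_poly; move/monicP: mon; rewrite lead_coefE szg /= => ->.
  by rewrite meval1 => /eqP; rewrite oner_eq0.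
set rho := a 0 0 / a 0 1; set r := mup rho u.
have unz := monic_neq0 monu.
have eL : L = a 0 1 *: ('X_0 - rho *: 'X_1).
  by rewrite scalerBr scalerA /rho mulrC divfK.
split.
  move=> _ [g Ig ->]; rewrite (pihomog_partitionE (leqnn (msize g))) /restrict_line.
  rewrite rmorph_sum /=; elim/big_ind: _.
  - by exists 0; rewrite mul0r.
  - by move=> _ _ [h1 ->] [h2 ->]; exists (h1 + h2); rewrite mulrDl.
  move=> d _; rewrite -/(restrict_line _ _) (restrict_line_homog v (pihomogP _ _ _)).
  have Igd := IH _ d Ig; set gd := pihomog _ _ _ in Igd *.
  have [e|nz] := eqVneq (fiber_poly v gd) 0.
    by exists 0; rewrite e linear0 mul0r.
  have dv : ('X - rho%:P) ^+ r %| fiber_poly v gd.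
    by apply: dvdp_trans (dvd _ Igd); rewrite -mup_geq.
  move: (dv) => /divpK; set w := (_ %/ _) => ew.
  have wn : w != 0 by apply: contraNneq nz => w0; rewrite -ew w0 mul0r.
  have szw : (r + size w <= d.+1)%N.
    have := leq_trans (size_fiber_poly v gd) (size_x0poly_homog (pihomogP _ _ _)).
    by rewrite -ew size_Mmonic ?monic_exp ?monicXsubC // size_exp_XsubC addnS addnC.
  have le_r : (r <= d)%N.
    by rewrite -ltnS (leq_trans _ szw) // -[ltnLHS]addn0 ltn_add2l size_poly_gt0.
  exists ((a 0 1) ^- r *: homogenize (d - r) w).
  rewrite -ew mulrC -{1}(subnKC le_r) homogenize_exp; last first.
    by rewrite -(leq_add2l r) addnS subnKC.
  rewrite eL exprZn -scalerAr -scalerAl scalerA divff ?expf_neq0 // scale1r.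
  by rewrite mulrC.
move=> /(_ (restrict_line v g0)) [|h e]; first by exists g0.
have := congr1 (@dehomogenize K) e.
rewrite dehomogenize_restrict eu rmorphM rmorphXn eL /=.
have -> : dehomogenize (a 0 1 *: ('X_0 - rho *: 'X_1)) = a 0 1 *: ('X - rho%:P).
  rewrite /dehomogenize -!mul_mpolyC rmorphM rmorphB rmorphM /= !mmapC.
  by rewrite !mmapX !mmap1U /= mulr1 mul_polyC.
move=> e'; have : ('X - rho%:P) ^+ r.+1 %| u.
  by rewrite e' exprZn dvdp_mull // dvdpZr ?expf_neq0.
by rewrite -mup_geq // ltnn.
Qed.
End FiberDivisor.

Lemma row2_eqmx (K : fieldType) (a b : 'rV[K]_2) : b 0 1 != 0 ->
  (b == a)%MS = (a 0 1 != 0) && (b 0 0 / b 0 1 == a 0 0 / a 0 1).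
Proof.
move=> b1; have ext (c d : 'rV[K]_2) : c 0 0 = d 0 0 -> c 0 1 = d 0 1 -> c = d.
  move=> e0 e1; apply/rowP => j; suff [->|->] : j = 0 \/ j = 1 by [].
  by case: j => [[|[|//]] hj]; [left|right]; apply: val_inj.
apply/idP/idP.
  case/andP => /sub_rVP[c eb] _; move: b1; rewrite eb !mxE mulf_eq0 negb_or.
  by case/andP => c0 a1; rewrite a1 -mulf_div divff // mul1r /=.
case/andP => a1 /eqP e; apply/andP; split; apply/sub_rVP.
  exists (b 0 1 / a 0 1); apply: ext; rewrite mxE; last by rewrite divfK.
  by rewrite mulrAC -mulrA -e mulrC divfK.
exists (a 0 1 / b 0 1); apply: ext; rewrite mxE; last by rewrite divfK.
by rewrite mulrAC -mulrA e mulrC divfK.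
Qed.

(** Over an algebraically closed field a monic polynomial is determined by its
    roots with multiplicities. *)
Lemma monic_eq_mup (K : closedFieldType) (p q : {poly K}) :
  p \is monic -> q \is monic -> (forall x, mup x p = mup x q) -> p = q.
Proof.
move=> /monicP lp /monicP lq.
have [rp ep] := closed_field_poly_normal p.
have [rq eq] := closed_field_poly_normal q.
rewrite ep eq lp lq !scale1r => h; apply: perm_big; apply/allP => x _ /=.
by rewrite -!mu_prod_XsubC h.
Qed.

Section DivisorEquation.
Variables (K : closedFieldType) (n : nat).
Variables (I : {mpoly K[n.+1]} -> Prop).
Hypothesis satI : saturated_homogeneous_ideal I.
Hypothesis pNZ : ~ closed_point_of I (center K n).
Implicit Types (g : {mpoly K[n.+1]}) (v : 'rV[K]_n) (u : {poly K}).

Definition affine_pt (x : K) : 'rV[K]_2 := \row_j (if j == 0 then x else 1).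

Lemma affine_pt_neq0 x : affine_pt x != 0.
Proof. by apply/eqP => /rowP /(_ 1); rewrite !mxE /= => /eqP; rewrite oner_eq0. Qed.

Lemma fiber_divisor_factors v u (T : eqType) (s : seq T) (r : T -> K) (e : T -> nat) :
  fiber_equation I v u -> u = \prod_(i <- s) ('X - (r i)%:P) ^+ e i ->
  fiber_divisor I v [seq (affine_pt (r i), e i) | i <- s].
Proof.
move=> hu eu; split=> [bm /mapP[i _ ->]|a a0]; first exact: affine_pt_neq0.
rewrite /div_coef big_map /=.
suff <- : root_mult u a = \sum_(i <- s | (affine_pt (r i) == a)%MS) e i.
  exact: fiber_mult.
have eqE i : (affine_pt (r i) == a)%MS = (a 0 1 != 0) && (r i == a 0 0 / a 0 1).
  by rewrite row2_eqmx !mxE /= ?oner_neq0 // divr1.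
rewrite /root_mult (eq_bigl _ _ eqE); case: eqP => _ /=; first by rewrite big_pred0.
by rewrite eu mup_prod_XsubC_exp.
Qed.

(** The quotient of coordinates is a junk value for points at infinity, which is
    harmless: their weights are 0. Points of D may be repeated, and the product
    adds up their weights just as [div_coef] does. *)
Lemma fiber_divisor_equation v u D :
  fiber_equation I v u -> fiber_divisor I v D ->
  u = \prod_(bm <- D) ('X - (bm.1 0 0 / bm.1 0 1)%:P) ^+ bm.2.
Proof.
move=> hu [D0 Dmult]; have [monu _ _] := hu.
have coefD a : a != 0 -> div_coef D a = root_mult u a.
  by move=> a0; apply: mult_at_unique (Dmult a a0) (fiber_mult satI pNZ hu a0).
apply: monic_eq_mup => [//||x]; first exact: monic_prod_XsubC_exp.
have := coefD _ (affine_pt_neq0 x); rewrite /root_mult !mxE /= oner_eq0 divr1 => <-.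
rewrite mup_prod_XsubC_exp /div_coef [LHS]big_mkcond [RHS]big_mkcond /=.
apply: eq_big_seq => bm hbm; have b0 := D0 _ hbm.
have [b1|b1] := eqVneq (bm.1 0 1) 0; last first.
  by rewrite row2_eqmx // !mxE /= oner_neq0 divr1.
suff -> : bm.2 = 0%N by rewrite !if_same.
have := coefD _ b0; rewrite /root_mult b1 eqxx /div_coef => /eqP.
rewrite sum_nat_seq_eq0 => /allP /(_ _ hbm) /implyP.
by rewrite submx_refl /= => /(_ isT) /eqP.
Qed.

Variables (le : rel 'X_{1..n.+1}) (G : seq {mpoly K[n.+1]}).
Hypothesis leP : elimination_ordering le.
Hypothesis homG : forall g, g \in G -> g \is ishomog mdeg.
Hypothesis GP : groebner_basis le I G.

(** The degree of the equation of the fiber is attained by a member of G, without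
    any drop of degree on the line. *)
Lemma groebner_fiber_equation v u : fiber_equation I v u ->
  exists g, [/\ g \in G, size (x0poly g) = size u
              & (lead_coef (x0poly g)).@[fun i => v 0 i] != 0].
Proof.
case=> monu dvd [f If ef]; have sz : size (fiber_poly v f) = (size u).-1.+1.
  by rewrite ef prednK // size_poly_gt0 monic_neq0.
have [d [h [Ih homh szh nz]]] := homog_specialized_degree_lift satI pNZ If sz.
have [g [Gg szg lcg]] : exists g, [/\ g \in G, (size (x0poly g) <= (size u).-1.+1)%N
    & (lead_coef (x0poly g)).@[fun i => v 0 i] != 0].
  apply: NNPP => no; case/negP: nz; apply/eqP.
  apply: (leading_coefs_vanish leP satI homG GP _ Ih homh szh) => g Gg szg.
  by apply/eqP/negPn/negP => lcg; apply: no; exists g.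
exists g; split=> //; apply/eqP; rewrite eqn_leq.
rewrite prednK ?size_poly_gt0 ?monic_neq0 // in szg; rewrite szg /=.
have nzg : fiber_poly v g != 0.
  apply: contraNneq lcg => g0.
  by rewrite lead_coefE -coef_fiber_poly g0 coef0.
have Ig : I g by case: GP => h' _; apply: h'.
exact: leq_trans (dvdp_leq nzg (dvd _ Ig)) (size_fiber_poly _ _).
Qed.
End DivisorEquation.

(** * Coincident root loci *)

(** Substituting c X in the product with roots c r_i gives c^deg times the product
    with roots r_i. *)
Lemma coef_scale_roots (K : fieldType) (I : Type) (s : seq I) (r : I -> K)
    (e : I -> nat) (c : K) m :
  c ^+ m * (\prod_(i <- s) ('X - (c * r i)%:P) ^+ e i)`_m =
  c ^+ (\sum_(i <- s) e i) * (\prod_(i <- s) ('X - (r i)%:P) ^+ e i)`_m.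
Proof.
have coefS (p : {poly K}) : (p \Po (c *: 'X))`_m = c ^+ m * p`_m.
  rewrite comp_polyE coef_sum (eq_bigr (fun i : 'I_(size p) =>
     (p`_i * c ^+ i) * (m == i)%:R)); last first.
    by move=> i _; rewrite exprZn scalerA coefZ coefXn.
  case: (ltnP m (size p)) => h; last first.
    rewrite nth_default // mulr0 big1 // => i _.
    by rewrite gtn_eqF ?mulr0 // (leq_trans (ltn_ord i)).
  rewrite (bigD1 (Ordinal h)) //= eqxx mulr1 mulrC big1 ?addr0 // => i ne.
  by rewrite eq_sym (inj_eq val_inj _ (Ordinal h)) (negPf ne) mulr0.
rewrite -coefS -coefZ; congr (polyseq _)`_m; rewrite -[RHS]mul_polyC.
elim: s => [|i s IH]; first by rewrite !big_nil mul1r rmorph1.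
rewrite !big_cons rmorphM /= IH rmorphXn rmorphB /= comp_polyX comp_polyC.
rewrite polyCM -mul_polyC -mulrBr exprMn exprD polyCM !polyC_exp.
by rewrite mulrACA.
Qed.

Section CoincidentRootLocus.
Variables (K : closedFieldType) (k e : nat) (lambda : 'I_e -> nat).
Hypothesis lambdaP : is_partition lambda k.
Implicit Types (a : 'rV[K]_k.+1) (f : {mpoly K[k.+1]}).

(** The binary form a at y = 1; it loses degree exactly when a_0 = 0. *)
Definition form_poly a : {poly K} := \sum_(j < k.+1) a 0 j *: 'X^(k - j).

Lemma coef_form_poly a (j : 'I_k.+1) : (form_poly a)`_(k - j) = a 0 j.
Proof.
rewrite coef_sum (bigD1 j) //= coefZ coefXn eqxx mulr1 big1 ?addr0 // => i ne.
rewrite coefZ coefXn; case: eqP => [e'|_]; last by rewrite mulr0.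
case/eqP: ne; apply: val_inj; rewrite /= -(subKn (leq_ord i)) -e'.
by rewrite subKn // leq_ord.
Qed.

Lemma form_polyK (p : {poly K}) : (size p <= k.+1)%N ->
  form_poly (\row_j p`_(k - j)) = p.
Proof.
move=> sz; apply/polyP => i; case: (ltnP i k.+1) => [lt_i|le_i].
  have <- : (k - rev_ord (Ordinal lt_i) = i)%N by rewrite /= subSS subKn.
  by rewrite coef_form_poly mxE.
rewrite [RHS]nth_default ?(leq_trans sz) // coef_sum big1 // => j _.
by rewrite coefZ coefXn gtn_eqF ?mulr0 // (leq_ltn_trans (leq_subr _ _)).
Qed.

Lemma binary_form_homogenize a : binary_form a = homogenize k (form_poly a).
Proof.
rewrite /binary_form /homogenize [RHS](reindex_inj rev_ord_inj).
apply: eq_bigr => j _ /=.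
by rewrite subSS coef_form_poly subKn // leq_ord.
Qed.

Lemma dehomogenize_form a : dehomogenize (binary_form a) = form_poly a.
Proof.
rewrite /binary_form rmorph_sum; apply: eq_bigr => j _ /=.
rewrite -mul_mpolyC !rmorphM !rmorphXn /= /dehomogenize mmapC !mmapX !mmap1U /=.
by rewrite expr1n mulr1 mul_polyC.
Qed.

(** For b = 0 the vector of coefficients is no point of projective space, but it
    is the multiple by 0 of a point of the locus, where the homogeneous
    components of f vanish. *)
Lemma coincident_root_locus_vanish f (r : 'I_e -> K) (b : K) :
  vanishing_ideal (coincident_root_locus lambda) f ->
  f.@[fun j : 'I_k.+1 =>
        (b *: \prod_(i < e) ('X - (r i)%:P) ^+ lambda i)`_(k - j)] = 0.
Proof.
case: (lambdaP) => _ sumk; set Q := (\prod_(i < e) _).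
have szQ : size Q = k.+1 by rewrite size_prod_XsubC_exp sumk.
pose a : 'rV[K]_k.+1 := \row_j Q`_(k - j).
have a0 : a != 0.
  apply/eqP => /rowP /(_ 0); rewrite !mxE subn0 -[k]/(k.+1.-1) -szQ -lead_coefE.
  by rewrite (monicP (monic_prod_XsubC_exp _ _ _)) => /eqP; rewrite oner_eq0.
move=> hf; have pt : pt_ideal a f.
  apply: hf => //; split=> //; exists 1, (fun i => 'X_0 - r i *: 'X_1); split=> [||].
  - exact: oner_neq0.
  - by move=> i; apply: rpredB; rewrite ?rpredZ // dhomogX /= mdeg1.
  rewrite scale1r binary_form_homogenize form_polyK ?szQ // -sumk.
  exact: homogenize_prod.
apply: etrans (pt_ideal_scale b pt).
by apply: meval_eq => j; rewrite /= mxE coefZ.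
Qed.

Lemma coincident_root_locusZ a c : c != 0 ->
  coincident_root_locus lambda a -> coincident_root_locus lambda (c *: a).
Proof.
move=> c0 [a0 [b [L [b0 homL eL]]]]; split; first by rewrite scaler_eq0 negb_or c0.
exists (b / c), L; split=> //; first by rewrite mulf_neq0 ?invr_eq0.
rewrite -eL; have -> : binary_form (c *: a) = c *: binary_form a.
  by rewrite scaler_sumr; apply: eq_bigr => j _; rewrite mxE scalerA.
by rewrite scalerA divfK.
Qed.

Lemma linear_formE (L : {mpoly K[2]}) :
  L \is 1.-homog -> L = L@_U_(0) *: 'X_0 + L@_U_(1) *: 'X_1.
Proof.
move=> hL; apply/mpolyP => m; rewrite mcoeffD !mcoeffZ !mcoeffX.
have [/mdeg1P [j /eqP ->]|ne] := boolP (mdeg m == 1%N).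
  rewrite !eq_mnm1; suff [->|->] : j = 0 \/ j = 1.
  - by rewrite eqxx mulr1 mulr0 addr0.
  - by rewrite mulr0 add0r eqxx mulr1.
  by case: j => [[|[|//]] hj]; [left|right]; apply: val_inj.
rewrite (dhomog_nemf_coeff hL) //.
have U j : (U_(j) == m :> 'X_{1..2})%MM = false.
  by apply/negbTE; apply: contraNneq ne => <-; rewrite mdeg1.
by rewrite !U !mulr0 addr0.
Qed.

(** Evaluating the factorization at (1 : 0) shows that no linear factor is a
    multiple of y, so each can be made monic in x. *)
Lemma coincident_root_locus_factor a :
  coincident_root_locus lambda a -> a 0 0 != 0 ->
  exists r, form_poly a = a 0 0 *: \prod_(i < e) ('X - (r i)%:P) ^+ lambda i.
Proof.
case: (lambdaP) => lgt0 _ [_ [c [L [c0 homL eL]]]] a0.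
pose w (i : 'I_2) : K := (i == 0)%:R.
have evL i : (L i).@[w] = (L i)@_U_(0).
  by rewrite {1}(linear_formE (homL i)) mevalD !mevalZ !mevalXU /= mulr1 mulr0 addr0.
have lead : c * a 0 0 = \prod_(i < e) (L i)@_U_(0) ^+ lambda i.
  have := congr1 (meval w) eL; rewrite mevalZ binary_form_homogenize.
  rewrite meval_homogenize // -[in X in (form_poly a)`_X](subn0 k).
  rewrite (coef_form_poly a 0) => ->.
  by rewrite rmorph_prod; apply: eq_bigr => i _; rewrite rmorphXn /= evL.
have nz i : (L i)@_U_(0) != 0.
  have : c * a 0 0 != 0 by rewrite mulf_neq0.
  rewrite lead => /prodf_neq0 /(_ i isT); apply: contraNneq => ->.
  by rewrite expr0n eqn0Ngt lgt0.
exists (fun i => - (L i)@_U_(1) / (L i)@_U_(0)).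
apply: (scalerI c0); rewrite scalerA lead.
have := congr1 (@dehomogenize K) eL.
rewrite -mul_mpolyC rmorphM /= dehomogenize_form {1}/dehomogenize mmapC mul_polyC => ->.
rewrite rmorph_prod -scaler_prod; apply: eq_bigr => i _.
rewrite rmorphXn -exprZn; congr (_ ^+ _).
rewrite {1}(linear_formE (homL i)) -!mul_mpolyC rmorphD !rmorphM /=.
rewrite !dehomogenizeC !dehomogenizeX /= mulr1 -mul_polyC mulrBr; congr (_ + _).
by rewrite -!polyCM -polyCN mulrCA divff // mulr1 opprK.
Qed.

(** The partition, read as a colouring of k roots by e colours in which colour i
    is used lambda_i times; [rep] picks one root of each colour. *)
Lemma block_exists : exists (blk : 'I_k -> 'I_e) (rep : 'I_e -> 'I_k),
  cancel rep blk /\ forall E : 'I_e -> {poly K},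
    \prod_(j < k) E (blk j) = \prod_(i < e) E i ^+ lambda i.
Proof.
case: (lambdaP) => lgt0 sumk.
pose bs := flatten [seq nseq (lambda i) i | i <- enum 'I_e].
have szb : size bs == k.
  rewrite size_flatten /shape -map_comp sumnE big_map big_enum /= -sumk.
  by apply/eqP/eq_bigr => i _; rewrite size_nseq.
have hb i : exists j, i == tnth (Tuple szb) j.
  have /tnthP[j ->] : i \in Tuple szb; last by exists j.
  apply/flattenP; exists (nseq (lambda i) i); last by rewrite mem_nseq lgt0 /=.
  by apply/mapP; exists i; rewrite ?mem_enum.
exists (tnth (Tuple szb)), (fun i => xchoose (hb i)); split.
  by move=> i; rewrite -(eqP (xchooseP (hb i))).
move=> E; rewrite -(big_tuple _ _ (Tuple szb) xpredT E) /= big_flatten big_map.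
rewrite big_enum; apply: eq_bigr => i _.
by rewrite big_nseq -Monoid.iteropE.
Qed.
End CoincidentRootLocus.

(** * Equations for the coincident root locus *)

Section Resolvent.
Variables (K : closedFieldType) (k : nat) (h : 'I_k -> 'I_k).

Lemma meval_msym (s : 'S_k) (f : {mpoly K[k]}) (y : 'I_k -> K) :
  (msym s f).@[y] = f.@[fun i => y (s i)].
Proof.
rewrite [RHS]mevalE /msym /mmap rmorph_sum; apply: eq_bigr => m _.
rewrite rmorphM /= mevalC /mmap1 rmorph_prod; congr (_ * _).
by apply: eq_bigr => i _; rewrite rmorphXn /= mevalXU.
Qed.

(** A generic linear combination of the differences y_j - y_(h j), with t as
    parameter: for fixed y it vanishes for all t only if all the differences
    do. *)
Definition block_form (t : K) : {mpoly K[k]} :=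
  \sum_(j < k) t ^+ j *: ('X_j - 'X_(h j)).

(** The product of all the permuted linear forms is symmetric in the roots, hence a
    polynomial in the elementary symmetric functions, which are the coefficients
    up to sign. *)
Lemma resolvent_exists (t : K) : exists F : {mpoly K[k]}, forall y : 'I_k -> K,
  F.@[fun i => (\prod_(j < k) ('X - (y j)%:P))`_(k - i.+1)] =
  \prod_(s : 'S_k) \sum_(j < k) t ^+ j * (y (s j) - y (s (h j))).
Proof.
pose Phi := \prod_(s : 'S_k) msym s (block_form t).
have symPhi : Phi \is symmetric.
  apply/issymP => s; rewrite rmorph_prod [RHS](reindex_inj (mulIg s)).
  by apply: eq_bigr => s' _; rewrite msymMm.
have [F0 [eF _]] := sym_fundamental symPhi.
exists (F0 \mPo [tuple (-1) ^+ i.+1 *: 'X_i | i < k]) => y.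
transitivity (Phi.@[y]); last first.
  rewrite /Phi rmorph_prod; apply: eq_bigr => s _.
  rewrite /= meval_msym rmorph_sum; apply: eq_bigr => j _.
  by rewrite /= mevalZ mevalB !mevalXU.
rewrite -eF !comp_mpoly_meval; apply: meval_eq => i.
rewrite !tnth_mktuple mevalZ mevalXU.
have := mroots_coeff [tuple y j | j < k] (lift ord0 i).
rewrite big_tuple; under eq_bigr do rewrite tnth_mktuple.
move=> -> /=; rewrite mulrA -exprD addnn -signr_odd odd_double mul1r.
by apply: meval_eq => j; rewrite tnth_mktuple.
Qed.

(** The product over the permutations is zero as a polynomial in t, so one factor
    is. *)
Lemma resolvent_separates (y : 'I_k -> K) :
  (forall t, \prod_(s : 'S_k) \sum_(j < k) t ^+ j * (y (s j) - y (s (h j))) = 0) ->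
  exists s : 'S_k, forall j, y (s j) = y (s (h j)).
Proof.
move=> van.
pose p (s : 'S_k) : {poly K} := \sum_(j < k) (y (s j) - y (s (h j))) *: 'X^j.
have : \prod_(s : 'S_k) p s == 0.
  apply/negPn/negP => /closed_nonrootP[t]; rewrite /root horner_prod.
  case/negP; apply/eqP; rewrite -[RHS](van t); apply: eq_bigr => s _.
  rewrite horner_sum; apply: eq_bigr => j _.
  by rewrite hornerZ hornerXn mulrC.
case/prodf_eq0 => s _ /eqP ps; exists s => j.
have := congr1 (fun q : {poly K} => q`_j) ps; rewrite coef0 coef_sum.
rewrite (bigD1 j) //= coefZ coefXn eqxx mulr1 big1 ?addr0 => [/eqP|i ne].
  by rewrite subr_eq0 => /eqP.
by rewrite coefZ coefXn eq_sym (inj_eq val_inj) (negPf ne) mulr0.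
Qed.
End Resolvent.

Section Closedness.
Variables (K : closedFieldType) (k e : nat) (lambda : 'I_e -> nat).
Hypothesis lambdaP : is_partition lambda k.

(** For a form with roots rho_j and leading coefficient a_0, the monic polynomial
    with roots a_0 rho_j has a_(i+1) a_0^i as its coefficient of degree
    k - i - 1. So the resolvent can be evaluated without dividing by a_0, and
    the extra factor a_0 makes it vanish on forms divisible by y as well. *)
Lemma homogeneous_resolvent_exists (h : 'I_k -> 'I_k) (t : K) :
  exists H : {mpoly K[k.+1]}, forall a : 'rV[K]_k.+1,
    (a 0 0 = 0 -> H.@[fun j => a 0 j] = 0) /\
    forall rho : 'I_k -> K,
      form_poly a = a 0 0 *: \prod_(j < k) ('X - (rho j)%:P) ->
      H.@[fun j => a 0 j] = a 0 0 * \prod_(s : 'S_k) \sum_(j < k)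
        t ^+ j * (a 0 0 * rho (s j) - a 0 0 * rho (s (h j))).
Proof.
have [F FE] := resolvent_exists h t.
exists ('X_0 * (F \mPo [tuple 'X_(lift ord0 i) * 'X_0 ^+ i | i < k])) => a.
rewrite mevalM mevalXU; split=> [->|rho ea]; first by rewrite mul0r.
have [->|a0] := eqVneq (a 0 0) 0; first by rewrite !mul0r.
congr (_ * _); rewrite -(FE (fun j => a 0 0 * rho j)) comp_mpoly_meval.
apply: meval_eq => i; rewrite tnth_mktuple mevalM rmorphXn /= !mevalXU.
have := coef_scale_roots (index_enum 'I_k) rho (fun=> 1%N) (a 0 0) (k - i.+1).
rewrite sum1_card card_ord => eQ.
apply: (mulfI (expf_neq0 (k - i.+1) a0)); rewrite [RHS]eQ.
have := coef_form_poly a (lift ord0 i); rewrite ea coefZ /= => <-.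
have -> : a 0 0 ^+ k = a 0 0 ^+ (k - i.+1) * (a 0 0 * a 0 0 ^+ i).
  by rewrite -exprS -exprD subnK.
rewrite -!mulrA; congr (_ * (_ * _)); rewrite mulrC /bump /= add1n.
by congr (_ * _`__); apply: eq_bigr => j _; rewrite expr1.
Qed.

(** For every t the resolvent is an equation of the locus, because it has a zero
    factor, that of the identity permutation, on forms with the required pattern
    of roots. If all these equations hold for P, some permutation of its roots
    makes all the differences within the blocks vanish. *)
Lemma coincident_root_locus_closed (P : {poly K}) : size P = k.+1 ->
  (forall f, vanishing_ideal (coincident_root_locus lambda) f ->
     f.@[fun j : 'I_k.+1 => P`_(k - j)] = 0) ->
  exists r, P = lead_coef P *: \prod_(i < e) ('X - (r i)%:P) ^+ lambda i.
Proof.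
move=> szP van; have [blk [rep [repK blkE]]] := block_exists K lambdaP.
pose h j := rep (blk j).
pose a : 'rV[K]_k.+1 := \row_j P`_(k - j).
have a0 : a 0 0 = lead_coef P by rewrite mxE lead_coefE szP subn0.
have nz : a 0 0 != 0 by rewrite a0 lead_coef_eq0 -size_poly_eq0 szP.
have [rs ePs] := closed_field_poly_normal P.
have szr : size rs == k.
  move: szP; rewrite ePs size_scale -?a0 // size_prod_XsubC => -[->] //.
pose rho := tnth (Tuple szr).
have eP : form_poly a = a 0 0 *: \prod_(j < k) ('X - (rho j)%:P).
  rewrite form_polyK ?szP // {1}ePs a0; congr (_ *: _).
  exact: (big_tuple _ _ (Tuple szr) xpredT (fun z => 'X - z%:P)).
have [|s hs] := resolvent_separates (h := h) (y := fun j => a 0 0 * rho j).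
  move=> t; have [H HE] := homogeneous_resolvent_exists h t.
  have /van : vanishing_ideal (coincident_root_locus lambda) H.
    move=> b _ Xb; apply/pt_idealP => c c0.
    have Xcb := coincident_root_locusZ c0 Xb.
    have -> : H.@[fun i => c * b 0 i] = H.@[fun i => (c *: b) 0 i].
      by apply: meval_eq => i; rewrite mxE.
    have [HE0 HE1] := HE (c *: b).
    have [/HE0 //|cb0] := eqVneq ((c *: b) 0 0) 0.
    have [r er] := coincident_root_locus_factor lambdaP Xcb cb0.
    rewrite (HE1 (fun j => r (blk j))); last first.
      by rewrite er -(blkE (fun i => 'X - (r i)%:P)).
    rewrite (bigD1 1%g) //= big1 ?mul0r ?mulr0 // => j _.
    by rewrite !perm1 /h repK subrr mulr0.
  have [_ HE1] := HE a; move: (HE1 _ eP).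
  rewrite (@meval_eq _ _ (fun j => a 0 j) (fun j => P`_(k - j))); last first.
    by move=> j; rewrite mxE.
  by move=> -> /eqP; rewrite mulf_eq0 (negPf nz) /= => /eqP.
exists (fun i => rho (s (rep i))).
rewrite -{1}(form_polyK (leq_trans (leqnn _) (eq_leq szP))) -/a eP a0; congr (_ *: _).
rewrite -(blkE (fun i => 'X - (rho (s (rep i)))%:P)) (reindex_inj (@perm_inj _ s)).
by apply: eq_bigr => j _; rewrite (mulfI nz (hs j)).
Qed.
End Closedness.

(** * Ramification loci *)

Lemma pt_ideal_homog (K : closedFieldType) m (v : 'rV[K]_m) d (f : {mpoly K[m]}) :
  f \is d.-homog -> f.@[fun i => v 0 i] = 0 -> pt_ideal v f.
Proof.
by move=> hf f0; apply/pt_idealP => c _; rewrite (dhomog_scale _ _ hf) f0 mulr0.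
Qed.

Section Assembly.
Variables (K : closedFieldType) (n : nat).
Variables (I : {mpoly K[n.+1]} -> Prop).
Hypothesis satI : saturated_homogeneous_ideal I.
Hypothesis pNZ : ~ closed_point_of I (center K n).
Implicit Types (g : {mpoly K[n.+1]}) (v : 'rV[K]_n) (u : {poly K}).

(** The root pattern on the line is the same for v and for c v: roots are
    multiplied by c. *)
Lemma fiber_poly_scale_factors (e : nat) (lambda : 'I_e -> nat) r b c d g v :
  c != 0 -> g \is d.-homog ->
  fiber_poly v g = b *: \prod_(i < e) ('X - (r i)%:P) ^+ lambda i ->
  exists b', fiber_poly (c *: v) g =
    b' *: \prod_(i < e) ('X - (c * r i)%:P) ^+ lambda i.
Proof.
move=> c0 hg ev; set k := (\sum_(i < e) lambda i)%N.
exists (c ^+ d * b / c ^+ k); apply/polyP => m.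
apply: (mulfI (expf_neq0 m c0)); rewrite (fiber_poly_scale _ _ _ hg) ev !coefZ.
rewrite [RHS]mulrCA (coef_scale_roots _ r lambda) -/k [RHS]mulrA.
by rewrite divfK ?expf_neq0 // mulrA.
Qed.

Lemma meval_eval_coefs k (F : {mpoly K[k.+1]}) g v :
  (eval_coefs F g).@[fun i => v 0 i] =
  F.@[fun j : 'I_k.+1 => (fiber_poly v g)`_(k - j)].
Proof.
rewrite comp_mpoly_meval; apply: meval_eq => j.
by rewrite tnth_mktuple coef_fiber_poly.
Qed.

(** A root x of the equation gives the point (x : v) of the scheme above v. *)
Lemma fiber_equation_image_pt v u :
  v != 0 -> fiber_equation I v u -> (1 < size u)%N -> image_pt I v.
Proof.
move=> v0 [monu dvd _] szu; case: (satI) => _ IH _.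
have [|x rx] := closed_rootP u _; first by rewrite neq_ltn szu orbT.
pose z : 'rV[K]_n.+1 := \row_i if unlift ord0 i is Some j then v 0 j else x.
have pz : proj_pt z = v by apply/rowP => j; rewrite !mxE liftK.
split=> //; exists z; split; last by rewrite pz submx_refl.
split.
  apply: contraNneq v0 => z0; rewrite -pz z0.
  by apply/eqP/rowP => j; rewrite !mxE.
move=> f If d; set fd := pihomog _ _ _.
have -> : fd.@[fun i => z 0 i] = (fiber_poly v fd).[x].
  by rewrite horner_fiber_poly; apply: meval_eq => i; rewrite mxE.
by apply/rootP/(root_dvdp _ rx)/dvd/IH.
Qed.

(** The divisor witnessing the length lists the roots one by one. *)
Lemma fiber_equation_length_ge k v u : v != 0 -> fiber_equation I v u ->
  (0 < k)%N -> (k < size u)%N -> Zlength_ge I k v.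
Proof.
move=> v0 hu k0 szu; split.
  by apply: fiber_equation_image_pt v0 hu _; apply: leq_ltn_trans szu.
have [monu _ _] := hu; have [rs eu] := closed_field_poly_normal u.
rewrite (monicP monu) scale1r in eu.
exists [seq (affine_pt x, 1%N) | x <- rs]; split.
  exact: (fiber_divisor_factors (r := id) (e := fun=> 1%N) satI pNZ hu eu).
rewrite /div_degree big_map sum1_size -ltnS.
by move: szu; rewrite {1}eu size_prod_XsubC.
Qed.
End Assembly.

Theorem corollary3p2 (K : closedFieldType) (charK : [pchar K] =i pred0)
    (n : nat) (n_gt0 : (0 < n)%N)
    (I : {mpoly K[n.+1]} -> Prop) (satI : saturated_homogeneous_ideal I)
    (pNZ : ~ closed_point_of I (center K n))
    (k : nat) (k_gt0 : (0 < k)%N)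
    (e : nat) (lambda : 'I_e -> nat) (lambdaP : is_partition lambda k)
    (le : rel 'X_{1..n.+1}) (leP : elimination_ordering le)
    (G : seq {mpoly K[n.+1]}) (homG : forall g, g \in G -> g \is ishomog mdeg)
    (GP : groebner_basis le I G)
    (s : nat) (F : 'I_s -> {mpoly K[k.+1]})
    (FP : forall f, vanishing_ideal (coincident_root_locus lambda) f <->
                    ideal_gen (fun h => exists i, h = F i) f) :
  set_defined_by (ramification_locus I k lambda) (ramification_ideal F G).
Proof.
move=> v v0; have [u hu] := fiber_equation_exists satI pNZ v.
have [monu dvd _] := hu.
have GI g : g \in G -> I g by case: GP => h _; exact: h.
case: (lambdaP) => _ sumk.
have szprod (r : 'I_e -> K) : size (\prod_(i < e) ('X - (r i)%:P) ^+ lambda i) = k.+1.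
  by rewrite size_prod_XsubC_exp sumk.
split=> [Yv|van].
  have small g : g \in G -> (size (x0poly g) < size u)%N -> fiber_poly v g = 0.
    move=> Gg szg; apply/eqP/negPn/negP => nz.
    have := dvdp_leq nz (dvd _ (GI _ Gg)); rewrite leqNgt => /negP[].
    exact: leq_ltn_trans (size_fiber_poly v g) szg.
  (* What both parts of the ramification locus have in common: the degree of u is
     at least k, and members of G of x_0-degree k restrict to multiples, possibly
     zero, of one power product of the given shape. *)
  have [szu shape] : (k < size u)%N /\ forall g, g \in G -> size (x0poly g) = k.+1 ->
      exists b r, fiber_poly v g = b *: \prod_(i < e) ('X - (r i)%:P) ^+ lambda i.
    case: Yv => [[_ [qt hD]]|[_ [D [hD degD]]]].
      pose r i := qt i 0 0 / qt i 0 1.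
      have eu : u = \prod_(i < e) ('X - (r i)%:P) ^+ lambda i.
        by rewrite (fiber_divisor_equation satI pNZ hu hD) big_map big_enum.
      split=> [|g Gg szg]; first by rewrite eu szprod.
      case/dvdpP: (dvd _ (GI _ Gg)) => q eq; exists q`_0, r.
      rewrite -eu eq -mul_polyC; congr (_ * _); apply: size1_polyC.
      have [->|q0] := eqVneq q 0; first by rewrite size_poly0.
      have := size_fiber_poly v g; rewrite szg eq size_Mmonic // eu szprod addnS /=.
      by rewrite -[k.+1]add1n leq_add2r.
    have eu := fiber_divisor_equation satI pNZ hu hD.
    have szu : (k.+1 < size u)%N by rewrite eu size_prod_XsubC_exp.
    split=> [|g Gg szg]; first exact: ltnW.
    by exists 0, (fun=> 0); rewrite scale0r small // szg.
  move=> f; apply: pt_ideal_gen => {f} f [[g [Gg szg ->]]|[i [g [Gg szg ->]]]].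
    have [d homg] := homogP _ _ (homG _ Gg).
    have [d' hl] := lead_coef_x0poly_homog homg.
    apply: pt_ideal_homog hl _.
    by rewrite lead_coefE -coef_fiber_poly small ?coef0 // (leq_ltn_trans szg).
  have [d homg] := homogP _ _ (homG _ Gg); have [b [r ev]] := shape g Gg szg.
  apply/pt_idealP => c c0; have [b' ecv] := fiber_poly_scale_factors c0 homg ev.
  rewrite (@meval_eq _ _ _ (fun j => (c *: v) 0 j)); last by move=> j; rewrite mxE.
  rewrite meval_eval_coefs ecv; apply: (coincident_root_locus_vanish lambdaP).
  by apply/FP/ideal_gen_id; exists i.
(* The converse: this g shows that deg u >= k, as otherwise its leading
   coefficient would be among the generators. *)
have [g [Gg szg lcg]] := groebner_fiber_equation satI pNZ leP homG GP hu.
have szu : (k < size u)%N.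
  rewrite ltnNge; apply/negP => le_k; case/negP: lcg; apply/eqP.
  apply/pt_ideal_meval/van/ideal_gen_id; left; exists g; split=> //.
  by rewrite szg.
move: (szu); rewrite leq_eqVlt => /predU1P[szk|lt_k]; last first.
  by right; apply: (fiber_equation_length_ge satI pNZ v0 hu _ lt_k).
have lc : (fiber_poly v g)`_k != 0.
  by move: lcg; rewrite lead_coefE -coef_fiber_poly szg -szk.
have szf : size (fiber_poly v g) = k.+1.
  apply/eqP; rewrite eqn_leq; have := size_fiber_poly v g; rewrite szg -szk => -> /=.
  by rewrite ltnNge; apply/negP => /leq_sizeP /(_ k (leqnn _)) /eqP; apply/negP.
have [f Xf|r er] := coincident_root_locus_closed lambdaP szf.
  have [t [ht ->]] := (FP f).1 Xf.
  rewrite rmorph_sum big1_seq //= => w /ht [i ->].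
  rewrite rmorphM /=; apply/eqP; rewrite mulf_eq0; apply/orP.
  right; rewrite -meval_eval_coefs; apply/eqP/pt_ideal_meval/van/ideal_gen_id.
  by right; exists i, g; rewrite szg -szk.
have eu : u = \prod_(i < e) ('X - (r i)%:P) ^+ lambda i.
  apply/eqP; rewrite -eqp_monic ?monic_prod_XsubC_exp //.
  rewrite -dvdp_size_eqp ?szprod -?szk //.
  have := dvd _ (GI _ Gg); rewrite er dvdpZr // lead_coef_eq0.
  by rewrite -size_poly_eq0 szf.
left; split; first by apply: (fiber_equation_image_pt satI v0 hu); rewrite -szk ltnS.
exists (fun i => affine_pt (r i)).
by apply: (fiber_divisor_factors satI pNZ hu); rewrite big_enum.
Qed.
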